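(* Let $f$ be a convex function on $\mathcal{X}$ with some minimizer $x^*$ and $f^*=f(x^* )$, and let $\psi$ be an $\alpha$-strongly convex mirror potential. Consider the approximate stochastic mirror descent iterations $$x^{(k+1)}=\nabla\psi^*\left(\nabla\psi(x^{(k)})-t_k\,\mathsf{G}(x^{(k)},\xi^{(k)})\right),\qquad k\ge0,$$ with step-sizes $t_k>0$, i.i.d. samples $\xi^{(k)}$, and inexact stochastic oracle $\mathsf{G}(x,\xi)=g(x)+\Delta(x,\xi)+U(x)$, where $g(x)\in\partial f(x)$, $\mathbb{E}_\xi[\Delta(x,\xi)]=0$, and $U(x)$ is deterministic. Suppose $\mathbb{E}[\|\mathsf{G}(x,\xi)\|_*^2]\le\sigma^2$ for all $x\in\mathcal{X}$, for some $\sigma\ge0$. Write $U_i=U(x^{(i)})$. 1. If $\langle U_i,x^{(i)}-x^*\rangle$ is uniformly bounded by $C$, then for every $k\ge 0$ $$\mathbb{E}\left[\sum_{i=0}^k t_i[f(x^{(i)})-f^*]\right]\le B_\psi(x^*,x^{(0)})+\frac{\sigma^2}{2\alpha}\sum_{i=0}^k t_i^2+C\sum_{i=0}^k t_i.$$ 2. If $f$ is $\mu$-strongly convex and $\|U_i\|_*^2$ is uniformly bounded by $C'$, then for every $k\ge 0$ $$\mathbb{E}\left[\sum_{i=0}^k t_i[f(x^{(i)})-f^*]\right]\le B_\psi(x^*,x^{(0)})+\frac{\sigma^2}{2\alpha}\sum_{i=0}^k t_i^2+\frac{C'}{2\mu}\sum_{i=0}^k t_i.$$ In particular, the ergodic average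 $\tilde x_0^k=\sum_{i=0}^k\gamma_i x^{(i)}$, $\gamma_i=t_i\big/\sum_{j=0}^k t_j$, satisfies, in cases 1 and 2 respectively, $$\mathbb{E}[f(\tilde x_0^k)-f^*]\le\left(B_\psi(x^*,x^{(0)})+\frac{\sigma^2}{2\alpha}\sum_{i=0}^k t_i^2\right)\Big/\left(\sum_{i=0}^k t_i\right)+C,$$ $$\mathbb{E}[f(\tilde x_0^k)-f^*]\le\left(B_\psi(x^*,x^{(0)})+\frac{\sigma^2}{2\alpha}\sum_{i=0}^k t_i^2\right)\Big/\left(\sum_{i=0}^k t_i\right)+\frac{C'}{2\mu}.$$
   Context: $\mathcal{X}=(\mathbb{R}^n,\|\cdot\|)$ is a finite-dimensional normed space with dual $\mathcal{X}^*=((\mathbb{R}^n)^*,\|\cdot\|_* )$, where $\|p\|_*=\sup\{\langle p,x\rangle:\|x\|\le1\}$ and $\langle p,x\rangle=p(x)$. The function $f$ is proper, convex, lower-semicontinuous with well-defined subgradients, and $g:\mathcal{X}\to\mathcal{X}^*$ satisfies $g(x)\in\partial f(x)$ for all $x$. A mirror potential is an $\alpha$-strongly convex ($\alpha>0$, with respect to $\|\cdot\|$) $\mathcal{C}^1$ function $\psi:\mathcal{X}\to\mathbb{R}$; $\psi^*$ is its convex conjugate, and $\nabla\psi^*=(\nabla\psi)^{-1}$. The Bregman divergence is $B_\psi(x,y)=\psi(x)-\psi(y)-\langle\nabla\psi(y),x-y\rangle$. The initial point $x^{(0)}\in\mathcal{X}$ is deterministic; $\xi^{(0)},\xi^{(1)},\dots$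 are i.i.d. samples of a random vector $\xi\in\Xi$; $U:\mathcal{X}\to\mathcal{X}^*$ models a deterministic approximation error. Strong convexity of $f$ with parameter $\mu>0$ is with respect to $\|\cdot\|$: $f(y)\ge f(x)+\langle g(x),y-x\rangle+\frac{\mu}{2}\|y-x\|^2$. *)

(* Defs.v *)
From mathcomp Require Import all_boot all_order all_algebra.
From mathcomp Require Import finmap.
From mathcomp Require Import all_classical all_reals all_analysis.

Set Implicit Arguments.
Unset Strict Implicit.
Unset Printing Implicit Defensive.

Import Order.TTheory GRing.Theory Num.Theory.
Import numFieldNormedType.Exports.

Local Open Scope classical_set_scope.
Local Open Scope ring_scope.

(* The space X is ['rV[R]_n] and its dual X^* is ['cV[R]_n], acting by matrix
   product.  The library norm of matrices is the sup norm; the norm of X is an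
   arbitrary function [nrm].  All norms on R^n are equivalent, so the library
   topology, differential and Borel sets are those of (X, nrm). *)

Section normed_space.
Context {R : realType} {n : nat}.
Local Notation X := 'rV[R]_n.
Local Notation X' := 'cV[R]_n.

Record is_norm (nrm : X -> R) : Prop := IsNorm {
  is_norm_triangle : forall x y, nrm (x + y) <= nrm x + nrm y ;
  is_norm_homog : forall (a : R) x, nrm (a *: x) = `|a| * nrm x ;
  is_norm_eq0 : forall x, nrm x = 0 -> x = 0 }.

Definition pairing (p : X') (x : X) : R := (x *m p) ord0 ord0.

Definition dual_norm (nrm : X -> R) (p : X') : R :=
  sup [set pairing p x | x in [set x | nrm x <= 1]].

Definition gradient (psi : X -> R) (x : X) : X' :=
  \col_i 'd psi x (delta_mx ord0 i).

(* Gradient of a function on the dual, with X^** identified with X. *)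
Definition dual_gradient (phi : X' -> R) (p : X') : X :=
  \row_i 'd phi p (delta_mx i ord0).

Definition convex_conjugate (psi : X -> R) (p : X') : \bar R :=
  ereal_sup [set (pairing p x - psi x)%:E | x in [set: X]].

(* [nabla psi^*]; the conjugate of a strongly convex function defined on all
   of X is finite everywhere, so [fine] loses nothing there. *)
Definition gradient_conjugate (psi : X -> R) : X' -> X :=
  dual_gradient (fun p => fine (convex_conjugate psi p)).

Definition bregman (psi : X -> R) (x y : X) : R :=
  psi x - psi y - pairing (gradient psi y) (x - y).

Local Open Scope ereal_scope.

Definition proper_function (f : X -> \bar R) : Prop :=
  (forall x, f x != -oo) /\ exists x, f x != +oo.

(* In the library [0 * +oo = 0], so the end points [a = 0, 1] are trivial. *)
Definition ereal_convex (f : X -> \bar R) : Prop :=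
  forall (a : R) (x y : X), (0 <= a <= 1)%R ->
    f (a *: x + (1 - a) *: y)%R <= a%:E * f x + (1 - a)%:E * f y.

Definition subdifferential (f : X -> \bar R) (x : X) : set X' :=
  [set p | forall y, f x + (pairing p (y - x))%:E <= f y].

(* [g] is a selection of subgradients of [f] (the gradient when [f] is C^1). *)
Definition strongly_convex (nrm : X -> R) (mu : R) (f : X -> \bar R)
    (g : X -> X') : Prop :=
  forall x y,
    f x + (pairing (g x) (y - x) + mu / 2 * nrm (y - x) ^+ 2)%:E <= f y.

Record mirror_potential (nrm : X -> R) (alpha : R) (psi : X -> R) : Prop :=
  MirrorPotential {
    mirror_differentiable : forall x, differentiable psi x ;
    mirror_continuous_gradient : continuous (gradient psi) ;
    mirror_strongly_convex :
      strongly_convex nrm alpha (fun x => (psi x)%:E) (gradient psi) }.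

End normed_space.

Notation borelType T := (g_sigma_algebraType (@open T)).

Section probability.
Context {d d' : measure_display} {Omega : measurableType d}
  {Xi : measurableType d'} {R : realType}.

Definition mutually_independent (P : probability Omega R)
    (xi : nat -> {RV P >-> Xi}) : Prop :=
  forall (J : {fset nat}) (A : nat -> set Xi), (forall i, measurable (A i)) ->
    P (\bigcap_(i in [set` J]) (xi i @^-1` A i)) =
    (\prod_(i <- J) P (xi i @^-1` A i))%E.

(* [law] is the distribution of the sampled random vector. *)
Definition iid (P : probability Omega R) (law : probability Xi R)
    (xi : nat -> {RV P >-> Xi}) : Prop :=
  mutually_independent xi /\
  forall i (A : set Xi), measurable A -> distribution P (xi i) A = law A.

End probability.

Definition ergodic_average {R : realType} {n : nat} (t : nat -> R)
    (x : nat -> 'rV[R]_n) (k : nat) : 'rV[R]_n :=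
  \sum_(i < k.+1) (t i / \sum_(j < k.+1) t j) *: x i.

(* Main.v *)
Require Import Defs.
From HB Require Import structures.
From mathcomp Require Import all_boot all_order all_algebra finmap.
From mathcomp Require Import all_classical all_reals all_analysis.
From mathcomp Require Import measurable_realfun ring lra.

Set Implicit Arguments.
Unset Strict Implicit.
Unset Printing Implicit Defensive.

Import Order.TTheory GRing.Theory Num.Theory.
Import numFieldNormedType.Exports.

Local Open Scope classical_set_scope.
Local Open Scope ring_scope.

(** The proof is the classical energy argument with the Bregman divergence
    [V_k = bregman psi xstar (x k)] as potential.

    Strong convexity makes [gradient psi] a strongly monotone bijection whose
    inverse is [gradient_conjugate psi] ([dpsiK], [dpsi_surj]), and the inverse
    is Lipschitz.  Hence one step of the method satisfies, pointwise, by the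
    three-point identity and Young's inequality ([mirror_descent_step]),

      [V_(k+1) + t_k <G(x_k, xi_k), x_k - xstar>
         <= V_k + t_k^2 |G(x_k, xi_k)|_*^2 / (2 alpha)].

    The iterate [x_k] is a measurable function of the noise before time [k], so
    it is independent of [xi_k]; this is shown by induction on [k], with the
    independence of [x_k] from all of [xi_k, xi_(k+1), ...] as the inductive
    statement ([process_cylinder]).  Fubini's theorem for the product of the
    law of [x_k] and the law of the noise then gives
    [E <G(x_k, xi_k), x_k - xstar> = E <g(x_k) + U(x_k), x_k - xstar>]
    ([integral_pairing_oracle]).  The functions [g] and [U] need not be
    measurable separately; their sum is, being the partial integral of [G].
    Integrability propagates along the induction, because [V_k] controls
    [|x_k - xstar|^2] and the second moment of [G] is bounded.

    In both cases of the theorem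
    [f(x_k) - f(xstar) <= <g(x_k) + U(x_k), x_k - xstar> + K] almost surely:
    with [K = C] by the subgradient inequality, and with [K = C' / (2 mu)] by
    strong convexity and Young's inequality.  Taking expectations and
    telescoping yields the first bound ([sum_gap_bound]); the bound on the
    ergodic average follows by Jensen's inequality ([gap_ergodic_average]). *)

(** * Norms and dual norms *)

Lemma lipschitz_bound_continuous {R : realType} {V W : normedModType R}
    (h : V -> W) (K : R) :
  (forall x y, `|h x - h y| <= K * `|x - y|) -> continuous h.
Proof.
move=> hK x; apply/cvgrPdist_le => e e0; near=> y.
apply: (le_trans (hK _ _)).
apply: (@le_trans _ _ ((1 + `|K|) * `|x - y|)).
  by rewrite ler_wpM2r// (le_trans (ler_norm _))// lerDr.
rewrite -ler_pdivlMl ?ltr_pwDl// mulrC.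
near: y; apply: cvgr_dist_le; first exact: cvg_id.
by rewrite divr_gt0// ltr_pwDl.
Unshelve. all: by end_near. Qed.

Section norm_theory.
Context {R : realType} {n : nat}.
Implicit Types (p q : 'cV[R]_n) (x y : 'rV[R]_n) (a : R).

Lemma pairingE p x : pairing p x = \sum_i x ord0 i * p i ord0.
Proof. by rewrite /pairing mxE. Qed.

Lemma pairingDr p x y : pairing p (x + y) = pairing p x + pairing p y.
Proof. by rewrite /pairing mulmxDl mxE. Qed.

Lemma pairingZr p a x : pairing p (a *: x) = a * pairing p x.
Proof. by rewrite /pairing -scalemxAl mxE. Qed.

Lemma pairingNr p x : pairing p (- x) = - pairing p x.
Proof. by rewrite -scaleN1r pairingZr mulN1r. Qed.

Lemma pairingBr p x y : pairing p (x - y) = pairing p x - pairing p y.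
Proof. by rewrite pairingDr pairingNr. Qed.

Lemma pairingDl p q x : pairing (p + q) x = pairing p x + pairing q x.
Proof. by rewrite /pairing mulmxDr mxE. Qed.

Lemma pairingZl a p x : pairing (a *: p) x = a * pairing p x.
Proof. by rewrite /pairing -scalemxAr mxE. Qed.

Lemma pairingNl p x : pairing (- p) x = - pairing p x.
Proof. by rewrite -scaleN1r pairingZl mulN1r. Qed.

Lemma pairingBl p q x : pairing (p - q) x = pairing p x - pairing q x.
Proof. by rewrite pairingDl pairingNl. Qed.

Lemma pairing_delta p i : pairing p (delta_mx ord0 i) = p i ord0.
Proof. by rewrite /pairing -rowE mxE. Qed.

Lemma pairing_delta_dual i x : pairing (delta_mx i ord0) x = x ord0 i.
Proof. by rewrite /pairing -colE mxE. Qed.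

Lemma coord_le_norm m k (A : 'M[R]_(m, k)) i j : `|A i j| <= `|A|.
Proof.
rewrite [leRHS]/Num.norm/= mx_normrE.
exact: (le_bigmax 0 (fun ij : 'I_m * 'I_k => `|A ij.1 ij.2|) (i, j)).
Qed.

Lemma pairing_le_norm p x : `|pairing p x| <= n%:R * `|p| * `|x|.
Proof.
rewrite pairingE (le_trans (ler_norm_sum _ _ _))//.
apply: (@le_trans _ _ (\sum_(i < n) `|p| * `|x|)).
  apply: ler_sum => i _; rewrite normrM mulrC.
  by apply: ler_pM => //; exact: coord_le_norm.
by rewrite sumr_const card_ord -[leLHS]mulr_natl mulrA.
Qed.

Lemma row_sum_coord x : x = \sum_i x ord0 i *: delta_mx ord0 i.
Proof. exact: row_sum_delta. Qed.

Variable nrm : 'rV[R]_n -> R.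
Hypothesis nrm_norm : is_norm nrm.

Lemma nrm0 : nrm 0 = 0.
Proof. by rewrite -(scale0r 0) (is_norm_homog nrm_norm) normr0 mul0r. Qed.

Lemma nrmN x : nrm (- x) = nrm x.
Proof. by rewrite -scaleN1r (is_norm_homog nrm_norm) normrN1 mul1r. Qed.

Lemma nrm_ge0 x : 0 <= nrm x.
Proof.
have := is_norm_triangle nrm_norm x (- x).
by rewrite subrr nrm0 nrmN -mulr2n pmulrn_lge0.
Qed.

Lemma nrm_le_norm : exists2 M, 0 < M & forall x, nrm x <= M * `|x|.
Proof.
exists (1 + \sum_(i < n) nrm (delta_mx ord0 i)).
  by rewrite ltr_pwDl// sumr_ge0// => i _; exact: nrm_ge0.
move=> x; apply: (@le_trans _ _ (\sum_(i < n) `|x| * nrm (delta_mx ord0 i))).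
  rewrite [in leLHS](row_sum_coord x).
  elim/big_ind2 : _ => [|u a v b ua vb|i _].
  - by rewrite nrm0.
  - by rewrite (le_trans (is_norm_triangle nrm_norm _ _))// lerD.
  - rewrite (is_norm_homog nrm_norm) ler_wpM2r ?nrm_ge0//.
    exact: coord_le_norm.
by rewrite -mulr_sumr mulrC ler_wpM2r// lerDr.
Qed.

Lemma nrm_dist x y : `|nrm x - nrm y| <= nrm (x - y).
Proof.
have h u v : nrm u - nrm v <= nrm (u - v).
  by rewrite lerBlDr -{1}(subrK v u) (is_norm_triangle nrm_norm).
by rewrite ler_norml h andbT lerNl opprB -[leRHS]nrmN opprB h.
Qed.

Lemma nrm_continuous : continuous nrm.
Proof.
have [M M0 nM] := nrm_le_norm.
apply: (@lipschitz_bound_continuous _ _ _ _ M) => x y.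
by rewrite (le_trans (nrm_dist _ _)).
Qed.

(** All norms on a finite-dimensional space are equivalent: [nrm] attains a
    positive minimum on the compact unit sphere of the sup norm. *)
Lemma norm_le_nrm : exists2 c, 0 < c & forall x, c * `|x| <= nrm x.
Proof.
pose S := [set x : 'rV[R]_n | `|x| = 1].
(* in dimension 0 the sphere is empty, and any constant works *)
have [[x0 Sx0]|S0] := pselect (S !=set0); last first.
  exists 1 => // x; have [->|x0] := eqVneq x 0; first by rewrite normr0 nrm0 mulr0.
  exfalso; apply: S0; exists (`|x|^-1 *: x).
  by rewrite /S/= normrZ normfV normr_id mulVf// normr_eq0.
have cS : compact S.
  apply: bounded_closed_compact.
    by exists 1; split=> // r r1 x /= ->; exact: ltW.
  rewrite (_ : S = (fun x : 'rV[R]_n => `|x|) @^-1` [set 1])//.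
  apply: closed_comp; last exact: closed_eq.
  by move=> x _; exact: norm_continuous.
have cn : {within S, continuous nrm}.
  exact/continuous_subspaceT/nrm_continuous.
have [c /set_mem Sc cmin] := compact_EVT_min (ex_intro _ x0 Sx0) cS cn.
have c0 : 0 < nrm c.
  rewrite lt_neqAle nrm_ge0 andbT eq_sym; apply/eqP => /(is_norm_eq0 nrm_norm) c0.
  by move: Sc; rewrite /S/= c0 normr0 => /esym/eqP; rewrite oner_eq0.
exists (nrm c) => // x; have [->|x1] := eqVneq x 0; first by rewrite normr0 nrm0 mulr0.
have nx0 : 0 < `|x| by rewrite normr_gt0.
rewrite -ler_pdivlMr// mulrC.
have := cmin (`|x|^-1 *: x); rewrite (is_norm_homog nrm_norm) normfV normr_id.
by apply; apply/mem_set; rewrite /S/= normrZ normfV normr_id mulVf// gt_eqF.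
Qed.

Let dual_set p := [set pairing p x | x in [set x | nrm x <= 1]].

Lemma has_sup_dual p : has_sup (dual_set p).
Proof.
split; first by exists 0, 0; rewrite /= ?nrm0// /pairing mul0mx mxE.
have [c c0 nc] := norm_le_nrm.
exists (n%:R * `|p| * c^-1) => _ [x /= x1 <-].
rewrite (le_trans (ler_norm _))// (le_trans (pairing_le_norm _ _))//.
rewrite ler_wpM2l// ?mulr_ge0// -[leRHS]mul1r ler_pdivlMr// mulrC.
by rewrite (le_trans (nc _)).
Qed.

Lemma dual_norm_ub p x : nrm x <= 1 -> pairing p x <= dual_norm nrm p.
Proof.
by move=> x1; apply: ub_le_sup; [exact: (has_sup_dual p).2 | exists x].
Qed.

Lemma dual_norm_le p b : (forall x, nrm x <= 1 -> pairing p x <= b) ->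
  dual_norm nrm p <= b.
Proof.
move=> h; apply: ge_sup; first exact: (has_sup_dual p).1.
by move=> _ [x /= x1 <-]; exact: h.
Qed.

Lemma dual_norm_ge0 p : 0 <= dual_norm nrm p.
Proof.
by rewrite (le_trans _ (@dual_norm_ub p 0 _)) ?nrm0// /pairing mul0mx mxE.
Qed.

Lemma pairing_le_dual p x : pairing p x <= dual_norm nrm p * nrm x.
Proof.
have [->|x0] := eqVneq x 0; first by rewrite /pairing mul0mx mxE nrm0 mulr0.
have nx : 0 < nrm x.
  rewrite lt_neqAle nrm_ge0 andbT eq_sym.
  by apply: contra_neq x0; exact: (is_norm_eq0 nrm_norm).
rewrite -ler_pdivrMr// mulrC -pairingZr dual_norm_ub//.
by rewrite (is_norm_homog nrm_norm) gtr0_norm ?invr_gt0// mulVf ?gt_eqF.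
Qed.

Lemma pairing_abs_le_dual p x : `|pairing p x| <= dual_norm nrm p * nrm x.
Proof.
rewrite ler_norml pairing_le_dual andbT lerNl -pairingNr -[nrm x]nrmN.
exact: pairing_le_dual.
Qed.

Lemma dual_norm_le_norm : exists2 K, 0 < K & forall p, dual_norm nrm p <= K * `|p|.
Proof.
have [c c0 nc] := norm_le_nrm.
(* [n.+1] rather than [n], so that the constant is positive if [n] is 0 *)
exists (n.+1%:R * c^-1); first by rewrite mulr_gt0// invr_gt0.
move=> p; apply: dual_norm_le => x x1.
rewrite (le_trans (ler_norm _))// (le_trans (pairing_le_norm _ _))//.
rewrite -[leRHS]mulrA [_^-1 * _]mulrC mulrA.
apply: ler_pM => //; first by rewrite ler_wpM2r// ler_nat.
by rewrite -[leRHS]mul1r ler_pdivlMr// mulrC (le_trans (nc _)).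
Qed.

Lemma dual_normD p q : dual_norm nrm (p + q) <= dual_norm nrm p + dual_norm nrm q.
Proof. by apply: dual_norm_le => x x1; rewrite pairingDl lerD// dual_norm_ub. Qed.

Lemma dual_normN p : dual_norm nrm (- p) = dual_norm nrm p.
Proof.
have h q : dual_norm nrm (- q) <= dual_norm nrm q.
  apply: dual_norm_le => x x1.
  by rewrite pairingNl -pairingNr dual_norm_ub// nrmN.
by apply/eqP; rewrite eq_le h/= -{1}(opprK p) h.
Qed.

Lemma dual_norm_continuous : continuous (dual_norm nrm).
Proof.
have [M M0 nM] := dual_norm_le_norm.
have h p q : dual_norm nrm p - dual_norm nrm q <= dual_norm nrm (p - q).
  by rewrite lerBlDr -{1}(subrK q p) dual_normD.
apply: (@lipschitz_bound_continuous _ _ _ _ M) => p q.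
rewrite (le_trans _ (nM _))// ler_norml h andbT lerNl opprB.
by rewrite -[leRHS]dual_normN opprB h.
Qed.

Lemma coord_le_dual p i : `|p i ord0| <= dual_norm nrm p * nrm (delta_mx ord0 i).
Proof. by rewrite -pairing_delta pairing_abs_le_dual. Qed.

End norm_theory.

(** * The mirror map and its inverse *)

Section mirror_map.
Context {R : realType} {n : nat}.
Variables (nrm : 'rV[R]_n -> R) (alpha : R) (psi : 'rV[R]_n -> R).
(* [dpsi] stands for the gradient of [psi]; only the strong convexity
   inequality and its continuity matter. *)
Variable dpsi : 'rV[R]_n -> 'cV[R]_n.
Hypotheses (nrm_norm : is_norm nrm) (alpha_gt0 : 0 < alpha).
Hypothesis psi_sc : strongly_convex nrm alpha (fun x => (psi x)%:E) dpsi.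
Implicit Types (p q : 'cV[R]_n) (x y z : 'rV[R]_n).

Lemma psi_lower_bound x y :
  psi x + pairing (dpsi x) (y - x) + alpha / 2 * nrm (y - x) ^+ 2 <= psi y.
Proof.
by have := psi_sc x y; rewrite -EFinD lee_fin addrA.
Qed.

Lemma dpsi_strongly_monotone x y :
  alpha * nrm (x - y) ^+ 2 <= pairing (dpsi x - dpsi y) (x - y).
Proof.
have := psi_lower_bound x y; have := psi_lower_bound y x.
rewrite -(opprB x y) (nrmN nrm_norm) pairingNr pairingBl.
set a := nrm _ ^+ 2; lra.
Qed.

Lemma convex_conjugate_ge q y :
  ((pairing q y - psi y)%:E <= convex_conjugate psi q)%E.
Proof. by apply: ereal_sup_ubound; exists y. Qed.

(** Young's inequality. *)
Lemma mul_le_sqr_div (a b c : R) : 0 < c ->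
  a * b <= a ^+ 2 / (2 * c) + c / 2 * b ^+ 2.
Proof.
move=> c0; rewrite -subr_ge0.
rewrite (_ : _ - _ = (a - c * b) ^+ 2 / (2 * c)).
  by rewrite divr_ge0 ?sqr_ge0// mulr_ge0// ltW.
by field; rewrite gt_eqF.
Qed.

(** Fenchel-Young inequality with a remainder: the affine minorant
    [q |-> <q, y> - psi y] of the conjugate is exact at [dpsi y], up to a
    quadratic error. *)
Lemma convex_conjugate_le q y :
  (convex_conjugate psi q <=
   (pairing q y - psi y
    + dual_norm nrm (q - dpsi y) ^+ 2 / (2 * alpha))%:E)%E.
Proof.
apply: ge_ereal_sup => _ [z _ <-]; rewrite lee_fin.
have := psi_lower_bound y z.
have := pairing_le_dual nrm_norm (q - dpsi y) (z - y).
have := mul_le_sqr_div (dual_norm nrm (q - dpsi y)) (nrm (z - y)) alpha_gt0.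
rewrite !pairingBl !pairingBr; lra.
Qed.

Lemma fine_convex_conjugate_bounds q y :
  pairing q y - psi y <= fine (convex_conjugate psi q) <= pairing q y - psi y
    + dual_norm nrm (q - dpsi y) ^+ 2 / (2 * alpha).
Proof.
have := convex_conjugate_ge q y; have := convex_conjugate_le q y.
by case: (convex_conjugate psi q) => [r| |] //=; rewrite !lee_fin => -> ->.
Qed.

(** The two bounds on the conjugate meet at [dpsi y] with a quadratic
    gap, so it is differentiable there with gradient [y]. *)
Lemma dpsiK : cancel dpsi (gradient_conjugate psi).
Proof.
move=> y; set p := dpsi y.
pose phi q := fine (convex_conjugate psi q).
have lin : linear (fun q => pairing q y : R).
  by move=> a u v; rewrite pairingDl pairingZl.
pose linM := GRing.isLinear.Build _ _ _ _ _ lin.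
pose L : {linear 'cV[R]_n -> R} := HB.pack (fun q => pairing q y : R) linM.
have Lc : continuous L.
  apply: (@lipschitz_bound_continuous _ _ _ _ (n%:R * `|y|)) => u v /=.
  by rewrite -pairingBl (le_trans (pairing_le_norm _ _))// mulrAC.
have dphi : 'd phi p = L :> (_ -> _).
  apply: diff_unique => //; apply/eqaddoP => e e0.
  have [K K0 dK] := dual_norm_le_norm nrm_norm.
  near=> h.
  rewrite [leLHS](_ : _ = `|phi (h + p) - (phi p + pairing h y)|)//.
  have /andP[l1 u1] := fine_convex_conjugate_bounds (h + p) y.
  have /andP[l2 u2] := fine_convex_conjugate_bounds p y.
  have d0 : dual_norm nrm 0 = 0.
    apply/eqP; rewrite eq_le (dual_norm_ge0 nrm_norm) andbT.
    by rewrite (le_trans (dK _))// normr0 mulr0.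
  move: l1 u1 l2 u2; rewrite -/p -!/(phi _) addrK subrr d0 expr0n/= mul0r addr0 pairingDl.
  move=> l1 u1 l2 u2.
  apply: (@le_trans _ _ (dual_norm nrm h ^+ 2 / (2 * alpha))).
    rewrite ler_norml; apply/andP; split; last lra.
    suff : 0 <= dual_norm nrm h ^+ 2 / (2 * alpha) by lra.
    by rewrite divr_ge0 ?sqr_ge0// mulr_ge0// ltW.
  apply: (@le_trans _ _ ((K * `|h|) ^+ 2 / (2 * alpha))).
    rewrite ler_pM2r ?invr_gt0 ?mulr_gt0//.
    by rewrite ler_pXn2r ?nnegrE ?mulr_ge0 ?(dual_norm_ge0 nrm_norm)// ltW.
  rewrite ler_pdivrMr ?mulr_gt0// exprMn (expr2 `|h|) mulrA [leRHS]mulrAC.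
  rewrite ler_wpM2r//.
  suff : `|h| <= e * (2 * alpha) / K ^+ 2 by rewrite ler_pdivlMr ?exprn_gt0// mulrC.
  near: h; apply: cvgr0_norm_le; first exact: cvg_id.
  by rewrite divr_gt0 ?exprn_gt0// !mulr_gt0.
apply/rowP => i; rewrite mxE /gradient_conjugate dphi/=.
exact: pairing_delta_dual.
Unshelve. all: by end_near. Qed.

Hypotheses (psi_continuous : continuous psi) (dpsi_continuous : continuous dpsi).

(** [psi - p] is coercive by strong convexity, so it attains its minimum, at
    which [dpsi] takes the value [p]. *)
Lemma dpsi_surj p : exists y, dpsi y = p.
Proof.
pose h z := psi z - pairing p z.
pose D := dual_norm nrm (dpsi 0 - p).
have D0 : 0 <= D by exact: dual_norm_ge0.
have hge z : h 0 - D * nrm z + alpha / 2 * nrm z ^+ 2 <= h z.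
  have := psi_lower_bound 0 z; rewrite subr0 /h /D.
  have := pairing_abs_le_dual nrm_norm (dpsi 0 - p) z.
  rewrite ler_norml => /andP[+ _]; rewrite pairingBl.
  rewrite [pairing p 0](_ : _ = 0) ?subr0; last by rewrite /pairing mul0mx mxE.
  lra.
pose B := [set z | nrm z <= 2 * D / alpha].
have B0 : B 0 by rewrite /B/= (nrm0 nrm_norm) divr_ge0 ?mulr_ge0// ltW.
have [c c0 nc] := norm_le_nrm nrm_norm.
have cB : compact B.
  apply: bounded_closed_compact.
    exists (2 * D / alpha / c); split; first by rewrite num_real.
    move=> r rD x /= xB; rewrite ltW// (le_lt_trans _ rD)//.
    by rewrite ler_pdivlMr// mulrC (le_trans (nc _)).
  rewrite (_ : B = nrm @^-1` [set r | r <= 2 * D / alpha])//.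
  apply: closed_comp; last exact: closed_le.
  by move=> x _; exact: nrm_continuous.
have pc : continuous (fun z : 'rV[R]_n => pairing p z).
  apply: (@lipschitz_bound_continuous _ _ _ _ (n%:R * `|p|)) => u v /=.
  by rewrite -pairingBr (le_trans (pairing_le_norm _ _)).
have hc : continuous h.
  by move=> z; exact: (cvgB (@psi_continuous z) (@pc z)).
have hcB : {within B, continuous h} by exact: continuous_subspaceT.
have [y _ ymin] := compact_EVT_min (ex_intro _ 0 B0) cB hcB.
have {}ymin z : h y <= h z.
  have [zB|zB] := leP (nrm z) (2 * D / alpha); first exact/ymin/mem_set.
  apply: (le_trans (ymin 0 _)); first exact/mem_set.
  apply: le_trans (hge z).
  have nz : 0 <= nrm z by exact: nrm_ge0.
  suff : 0 <= nrm z * (alpha / 2 * nrm z - D) by lra.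
  rewrite mulr_ge0// subr_ge0; move: zB; rewrite ltr_pdivrMr//; lra.
exists y.
pose u : 'rV[R]_n := (dpsi y - p)^T.
(* the one-sided optimality condition along the direction [- u] *)
have ge0 : 0 <= pairing (dpsi y - p) (- u).
  pose k (s : R) := pairing (dpsi (y - s *: u) - p) (- u).
  have kc : continuous k.
    have c1 : continuous (fun q => pairing q (- u) : R).
      apply: (@lipschitz_bound_continuous _ _ _ _ (n%:R * `|- u|)) => a b /=.
      by rewrite -pairingBl (le_trans (pairing_le_norm _ _))// mulrAC.
    have c2 : continuous (fun s : R => y - s *: u).
      apply: (@lipschitz_bound_continuous _ _ _ _ `|u|) => a b.
      by rewrite opprD opprK addrACA subrr add0r addrC -scalerBl normrZ distrC mulrC.
    move=> s; apply: (continuous_comp (f := fun s : R => dpsi (y - s *: u) - p) _ (c1 _)).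
    apply: cvgB; last exact: cvg_cst.
    apply: (continuous_comp (f := fun s : R => y - s *: u) (c2 _)).
    exact: dpsi_continuous.
  suff : 0 <= k 0 by rewrite /k scale0r subr0.
  have kr : k s @[s --> 0^'+] --> k 0 by apply: cvg_at_right_filter; exact: kc.
  rewrite -(cvg_lim _ kr)//; apply: limr_ge; first by apply/cvg_ex; exists (k 0).
  near=> s.
  have s0 : 0 < s by near: s; exact: nbhs_right_gt.
  have := ymin (y - s *: u); have := psi_lower_bound (y - s *: u) y.
  rewrite opprD opprK addrA subrr add0r /h /k !pairingNr !pairingBl !pairingBr !pairingZr.
  have q0 : 0 <= alpha / 2 * nrm (s *: u) ^+ 2 by rewrite mulr_ge0 ?sqr_ge0 ?divr_ge0// ltW.
  move=> h1 h2.
  have : 0 <= s * - (pairing (dpsi (y - s *: u)) u - pairing p u) by lra.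
  by rewrite pmulr_rge0.
apply/eqP; rewrite -subr_eq0; apply/eqP/matrixP => i j.
have uE k : u ord0 k = (dpsi y - p) k ord0 by rewrite mxE.
rewrite ord1 {j} [RHS]mxE -uE.
move: ge0; rewrite pairingNr oppr_ge0 pairingE => le0.
have sq : \sum_i u ord0 i * (dpsi y - p) i ord0 = \sum_i u ord0 i ^+ 2.
  by apply: eq_bigr => k _; rewrite expr2 -uE.
move: le0; rewrite sq => le0.
have /eqP : \sum_i u ord0 i ^+ 2 = 0.
  by apply/eqP; rewrite eq_le le0 sumr_ge0// => k _; exact: sqr_ge0.
rewrite psumr_eq0; last by move=> k _; exact: sqr_ge0.
move=> /allP/(_ i (mem_index_enum _))/=; rewrite sqrf_eq0 => /eqP.
Unshelve. all: by end_near. Qed.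

Lemma gradient_conjugateK : cancel (gradient_conjugate psi) dpsi.
Proof. by move=> p; have [y <-] := dpsi_surj p; rewrite dpsiK. Qed.

Lemma gradient_conjugate_lipschitz p q :
  alpha * nrm (gradient_conjugate psi p - gradient_conjugate psi q)
  <= dual_norm nrm (p - q).
Proof.
have := gradient_conjugateK p; have := gradient_conjugateK q.
move: (gradient_conjugate psi p) (gradient_conjugate psi q) => x y dy dx.
have [->|xy] := eqVneq x y.
  by rewrite subrr (nrm0 nrm_norm) mulr0 (dual_norm_ge0 nrm_norm).
have n0 : 0 < nrm (x - y).
  rewrite lt_neqAle (nrm_ge0 nrm_norm) andbT eq_sym; apply: contra_neq xy.
  by move/(is_norm_eq0 nrm_norm)/eqP; rewrite subr_eq0 => /eqP.
rewrite -(ler_pM2r n0) -mulrA -expr2.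
apply: (le_trans (dpsi_strongly_monotone x y)).
by rewrite dx dy pairing_le_dual.
Qed.

Lemma gradient_conjugate_continuous : continuous (gradient_conjugate psi).
Proof.
have [c c0 nc] := norm_le_nrm nrm_norm.
have [K K0 dK] := dual_norm_le_norm nrm_norm.
apply: (@lipschitz_bound_continuous _ _ _ _ (K / (alpha * c))) => p q.
rewrite mulrAC ler_pdivlMr ?mulr_gt0// mulrC -mulrA.
apply: le_trans (dK _); apply: le_trans (gradient_conjugate_lipschitz p q).
by rewrite ler_pM2l.
Qed.

(** One step of mirror descent, by the three-point identity of the Bregman
    divergence and Young's inequality. *)
Lemma mirror_three_point (z y y' : 'rV[R]_n) (p u : 'cV[R]_n) (s : R) :
  0 <= s -> u = dpsi y ->
  psi z - psi y' - pairing (u - s *: p) (z - y') + s * pairing p (y - z)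
  <= psi z - psi y - pairing u (z - y)
     + s ^+ 2 * (dual_norm nrm p ^+ 2 / (2 * alpha)).
Proof.
move=> s0 uy.
have := psi_lower_bound y y'; rewrite -uy.
have := ler_wpM2l s0 (pairing_le_dual nrm_norm p (y - y')).
have := mul_le_sqr_div (s * dual_norm nrm p) (nrm (y - y')) alpha_gt0.
rewrite -(opprB y y') (nrmN nrm_norm) mulrA exprMn -[_ * _ / (2 * alpha)]mulrA.
rewrite !(pairingBl, pairingZl, pairingNr, pairingBr); lra.
Qed.

End mirror_map.

Section mirror_potential_theory.
Context {R : realType} {n : nat}.
Variables (nrm : 'rV[R]_n -> R) (alpha : R) (psi : 'rV[R]_n -> R).
Hypotheses (nrm_norm : is_norm nrm) (alpha_gt0 : 0 < alpha).
Hypothesis psi_mirror : mirror_potential nrm alpha psi.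

Lemma mirror_continuous : continuous psi.
Proof.
by move=> x; exact/differentiable_continuous/(mirror_differentiable psi_mirror).
Qed.

Lemma bregman_ge x y : alpha / 2 * nrm (x - y) ^+ 2 <= bregman psi x y.
Proof.
have := psi_lower_bound (mirror_strongly_convex psi_mirror) y x.
by rewrite /bregman; lra.
Qed.

Lemma bregman_ge0 x y : 0 <= bregman psi x y.
Proof.
by rewrite (le_trans _ (bregman_ge x y))// mulr_ge0 ?sqr_ge0// divr_ge0// ltW.
Qed.


Lemma mirror_gradient_conjugateK :
  cancel (gradient_conjugate psi) (gradient psi).
Proof.
exact: (gradient_conjugateK nrm_norm alpha_gt0
  (mirror_strongly_convex psi_mirror) mirror_continuous
  (mirror_continuous_gradient psi_mirror)).
Qed.

Lemma mirror_gradient_conjugate_continuous : continuous (gradient_conjugate psi).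
Proof.
exact: (gradient_conjugate_continuous nrm_norm alpha_gt0
  (mirror_strongly_convex psi_mirror) mirror_continuous
  (mirror_continuous_gradient psi_mirror)).
Qed.

Lemma mirror_descent_step (z y : 'rV[R]_n) (p : 'cV[R]_n) (s : R) :
  0 <= s ->
  bregman psi z (gradient_conjugate psi (gradient psi y - s *: p))
    + s * pairing p (y - z)
  <= bregman psi z y + s ^+ 2 * (dual_norm nrm p ^+ 2 / (2 * alpha)).
Proof.
move=> s0; rewrite /bregman mirror_gradient_conjugateK.
exact: (mirror_three_point nrm_norm alpha_gt0
  (mirror_strongly_convex psi_mirror)).
Qed.

End mirror_potential_theory.

(** * Borel measurability *)

Section borel.
Context {R : realType}.

Lemma measurable_fun_borel d (T : measurableType d) (V : ptopologicalType)
    (Y : T -> V) :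
  (forall W : set V, open W -> measurable (Y @^-1` W)) ->
  measurable_fun [set: T] (Y : T -> borelType V).
Proof.
move=> mY; apply: (@measurability _ _ _ (borelType V) _ _ (@open V)) => //.
by move=> _ [W oW <-]; rewrite setTI; exact: mY.
Qed.

Lemma continuous_borel_measurable (U V : ptopologicalType) (h : U -> V) :
  continuous h -> measurable_fun [set: borelType U] (h : borelType U -> borelType V).
Proof.
move=> /continuousP ch; apply: measurable_fun_borel => W oW.
by apply: sub_sigma_algebra; exact: ch.
Qed.

Lemma continuous_borel_measurable_real (U : ptopologicalType) (h : U -> R) :
  continuous h -> measurable_fun [set: borelType U] (h : borelType U -> R).
Proof.
move=> /continuousP ch mU; apply: (measurability _ (RGenOpens.measurableE R)) => //.
move=> _ [_ [a [b ->]] <-]; rewrite setTI; apply: sub_sigma_algebra.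
exact/ch/interval_open.
Qed.

Lemma lower_semicontinuous_borel_measurable (U : ptopologicalType) (h : U -> \bar R) :
  lower_semicontinuous h -> measurable_fun [set: borelType U] (h : borelType U -> \bar R).
Proof.
move=> lh mU; apply: (measurability _ (ErealGenOInfty.measurableE R)) => //.
move=> /= _ [_ [a ->]] <-; rewrite setTI; apply: sub_sigma_algebra.
by rewrite preimage_itvoy; move/lower_semicontinuousP : lh; exact.
Qed.

(** A matrix-valued function with measurable entries is Borel measurable: an
    open set is a countable union of boxes with rational centres. *)
Lemma measurable_fun_mx d (T : measurableType d) m k (Y : T -> 'M[R]_(m, k)) :
  (forall i j, measurable_fun [set: T] (fun w => Y w i j)) ->
  measurable_fun [set: T] (Y : T -> borelType 'M[R]_(m, k)).
Proof.
move=> mY; apply: measurable_fun_borel => W oW.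
pose I := ('M[rat]_(m, k) * nat)%type.
pose box (q : I) : set 'M[R]_(m, k) :=
  [set B | forall i j, `|ratr (q.1 i j) - B i j| < q.2.+1%:R^-1].
have -> : Y @^-1` W = \bigcup_(q in [set q | box q `<=` W]) (Y @^-1` box q).
  apply/seteqP; split => [w /= YW|w [q qW]]; last exact: qW.
  have /nbhs_ballP[e /= e0 eW] := open_nbhs_nbhs (conj oW YW).
  have [l le] : exists l : nat, l.+1%:R^-1 < e / 2 :> R.
    exists (Num.bound (e / 2)^-1).
    rewrite invf_plt ?posrE ?divr_gt0//.
    rewrite (lt_le_trans (archi_boundP _)) ?ler_nat ?invr_ge0 ?divr_ge0// ?ltW//.
  have l0 : 0 < l.+1%:R^-1 :> R by rewrite invr_gt0.
  (* a rational centre within [l.+1^-1] of [Y w]: two such radii fit in [e] *)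
  have /choice[q hq] : forall ij : 'I_m * 'I_k, exists r : rat,
      `|ratr r - Y w ij.1 ij.2| < l.+1%:R^-1.
    move=> [i j] /=.
    have /rat_in_itvoo[r] : Y w i j < Y w i j + l.+1%:R^-1 by rewrite ltrDl.
    rewrite in_itv/= => /andP[r1 r2]; exists r.
    by rewrite gtr0_norm ?subr_gt0// ltrBlDl.
  pose A : 'M[rat]_(m, k) := \matrix_(i, j) q (i, j).
  exists (A, l) => /=; last by move=> i j; rewrite /= mxE; exact: (hq (i, j)).
  move=> B AB; apply: eW; split => // i j; rewrite /ball/=.
  have := AB i j; rewrite /= mxE => h1; have := hq (i, j) => /= h2.
  rewrite -(subrK (ratr (q (i, j))) (Y w i j)) -addrA.
  rewrite (le_lt_trans (ler_normD _ _))// distrC.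
  by rewrite (splitr e) ltrD//; exact: lt_trans le.
rewrite bigcup_mkcond; apply: countable_bigcupT_measurable.
  exact: countableP.
move=> q; case: ifPn => // _.
rewrite (_ : _ @^-1` _ = \bigcap_(ij in [set: 'I_m * 'I_k])
    [set w | `|ratr (q.1 ij.1 ij.2) - Y w ij.1 ij.2| < q.2.+1%:R^-1]); last first.
  by apply/seteqP; split => w /= h => [[i j] _|i j]; [exact: h|exact: (h (i, j))].
apply: fin_bigcap_measurable => // -[i j] _ /=.
rewrite (_ : [set w | _] = [set: T] `&` (fun w => Y w i j) @^-1`
    `]ratr (q.1 i j) - q.2.+1%:R^-1, ratr (q.1 i j) + q.2.+1%:R^-1[%classic).
  exact: mY.
by rewrite setTI; apply/seteqP; split => w /=; rewrite in_itv/= -ltr_distl distrC.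
Qed.

End borel.

(** * Independence of the iterates from future noise *)

Section independence.
Context {d d' ds : measure_display} {Omega : measurableType d}
  {Xi : measurableType d'} {S : measurableType ds} {R : realType}.
Variables (P : probability Omega R) (law : probability Xi R).
Variable xi : nat -> {RV P >-> Xi}.
Hypothesis xi_iid : iid law xi.

Lemma iid_cylinder (J : {fset nat}) (A : nat -> set Xi) :
  (forall i, measurable (A i)) ->
  P (\bigcap_(i in [set` J]) (xi i @^-1` A i)) = (\prod_(i <- J) law (A i))%E.
Proof.
move=> mA; rewrite (xi_iid.1 J A)//; apply: eq_bigr => i _.
by rewrite -(xi_iid.2 i).
Qed.

Lemma prod_probability_fin_num (I : Type) (s : seq I) (A : I -> set Xi) :
  (forall i, measurable (A i)) ->
  (\prod_(i <- s) law (A i))%E \is a fin_num.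
Proof.
move=> mA; elim/big_rec : _ => // i r _ hr.
by rewrite fin_numM// fin_num_measure.
Qed.

(* A process driven by the noise: the state at time [k.+1] is a measurable
   function of the state and the noise at time [k]. *)
Variables (Phi : nat -> S * Xi -> S) (x : nat -> Omega -> S) (x0 : S).
Hypothesis Phi_measurable : forall k, measurable_fun [set: S * Xi] (Phi k).
Hypothesis x_init : forall w, x 0%N w = x0.
Hypothesis x_step : forall k w, x k.+1 w = Phi k (x k w, xi k w).

Lemma process_measurable k : measurable_fun [set: Omega] (x k).
Proof.
elim: k => [|k IH].
  by rewrite (_ : x 0%N = cst x0); [exact: measurable_cst | exact/funext].
rewrite (_ : x k.+1 = Phi k \o (fun w => (x k w, xi k w))); last exact/funext.
by apply: measurableT_comp => //; exact: measurable_fun_pair.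
Qed.

(** The state at time [k] is independent of the noise from time [k] on.  The
    whole future noise is needed for the induction: passing to [k.+1] moves
    [xi k] from the noise into the state. *)
Lemma process_cylinder k (J : {fset nat}) (A : nat -> set Xi) (B : set S) :
  (forall i, i \in J -> (k <= i)%N) -> (forall i, measurable (A i)) ->
  measurable B ->
  P (x k @^-1` B `&` \bigcap_(i in [set` J]) (xi i @^-1` A i))
  = (P (x k @^-1` B) * \prod_(i <- J) law (A i))%E.
Proof.
elim: k => [|k IH] in J A B * => kJ mA mB.
  rewrite -iid_cylinder//; have [Bx0|Bx0] := pselect (B x0).
    rewrite (_ : x 0%N @^-1` B = setT); last first.
      by apply/seteqP; split => // w _; rewrite /preimage/= x_init.
    by rewrite setTI probability_setT mul1e.
  rewrite (_ : x 0%N @^-1` B = set0); last first.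
    by apply/seteqP; split => // w; rewrite /preimage/= x_init.
  by rewrite set0I measure0 mul0e.
pose E := \bigcap_(i in [set` J]) (xi i @^-1` A i).
have mxi i C : measurable C -> measurable (xi i @^-1` C).
  by move=> mC; rewrite -[X in measurable X]setTI; exact: measurable_funP.
have mE : measurable E.
  by apply: fin_bigcap_measurable => // i _; exact: mxi.
pose Z w := (x k w, xi k w).
have mZ : measurable_fun [set: Omega] Z.
  by apply: measurable_fun_pair => //; exact: process_measurable.
have c0 : (0 <= \prod_(i <- J) law (A i))%E by apply: prode_ge0.
have cfin : (\prod_(i <- J) law (A i))%E \is a fin_num by exact: prod_probability_fin_num.
have c0' : 0 <= fine (\prod_(i <- J) law (A i))%E by exact: fine_ge0.
pose c : {nonneg R} := NngNum c0'.
have cE : (\prod_(i <- J) law (A i))%E = (c%:num)%:E by rewrite fineK.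
pose m1 := pushforward (mrestr P mE) Z.
pose m2 := mscale c (pushforward P Z).
pose G : set (set (S * Xi)) :=
  [set C | exists A1, measurable A1 /\ exists A2, measurable A2 /\ C = A1 `*` A2].
(* both measures agree on rectangles, by the inductive hypothesis for the
   index sets [k |` J] and [{k}] *)
have key M : measurable M -> m1 M = m2 mZ M.
  move=> mM; apply: (measure_unique G (fun=> setT)) => //; rewrite ?/m1.
  - rewrite measurable_prod_measurableType //; congr (<<s _ >>).
    rewrite predeqE; split => [[A1 mA1 [A2 mA2 <-]]|[A1 [mA1 [A2 [mA2 ->]]]]].
      by exists A1; split => //; exists A2.
    by exists A1 => //; exists A2.
  - move=> _ _ [X1 [mX1 [X2 [mX2 ->]]]] [Y1 [mY1 [Y2 [mY2 ->]]]].
    rewrite -setXI; exists (X1 `&` Y1); split; first exact: measurableI.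
    by exists (X2 `&` Y2); split => //; exact: measurableI.
  - by move=> _; exists setT; split => //; exists setT; split => //; rewrite setXTT.
  - by rewrite bigcup_const.
  - move=> _ [A1 [mA1 [A2 [mA2 ->]]]].
    rewrite /m1 /m2 /= /mscale /pushforward /mrestr -cE.
    have kJn : k \notin J.
      by apply/negP => /kJ; rewrite ltnn.
    pose A' i := if i == k then A2 else A i.
    have A'k : A' k = A2 by rewrite /A' eqxx.
    have mA' i : measurable (A' i) by rewrite /A'; case: ifPn.
    have eJ : (\prod_(i <- J) law (A' i) = \prod_(i <- J) law (A i))%E.
      rewrite big_seq [RHS]big_seq; apply: eq_bigr => i iJ; rewrite /A'.
      by case: eqP => // ik; move: kJn; rewrite -ik iJ.
    have E1 : P (x k @^-1` A1 `&` xi k @^-1` A2) = (P (x k @^-1` A1) * law A2)%E.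
      have := IH [fset k]%fset (fun=> A2) A1.
      rewrite big_seq_fset1 set_fset1 bigcap_set1; apply => //.
      by move=> i; rewrite inE => /eqP ->.
    have E2 : P (x k @^-1` A1 `&` xi k @^-1` A2 `&` E)
        = (P (x k @^-1` A1) * (law A2 * \prod_(i <- J) law (A i)))%E.
      have := IH (k |` J)%fset A' A1; rewrite big_fsetU1//= eJ A'k => <- //.
        rewrite -setIA; congr (P (_ `&` _)).
        apply/seteqP; split => w /=.
          move=> [h1 h2] i /=; rewrite !inE /A' => /orP[/eqP ->|iJ]; first by rewrite eqxx.
          by case: eqP => [->|_]; [exact: h1 | exact: h2].
        move=> h; split; first by have := h k; rewrite /= !inE eqxx /A' eqxx; exact.
        move=> i /= iJ; have := h i; rewrite /= !inE iJ orbT /A'.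
        by case: eqP => [ik|_]; [move: kJn; rewrite -ik iJ | exact].
      by move=> i; rewrite !inE => /orP[/eqP ->//|/kJ/ltnW].
    rewrite (_ : Z @^-1` (A1 `*` A2) = x k @^-1` A1 `&` xi k @^-1` A2)//.
    apply: (etrans E2); rewrite muleA muleC; congr (_ * _)%E; exact/esym/E1.
  - move=> _; rewrite /m1 /pushforward /mrestr/=.
    rewrite (le_lt_trans (probability_le1 _ _)) ?ltry//.
    by apply: measurableI => //; rewrite preimage_setT.
have mPB : measurable (Phi k @^-1` B).
  by rewrite -[X in measurable X]setTI; exact: Phi_measurable.
have ZE : x k.+1 @^-1` B = Z @^-1` (Phi k @^-1` B).
  by apply/seteqP; split => w; rewrite /preimage/= x_step.
rewrite ZE muleC cE; exact: key.
Qed.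

Lemma process_independent k (B : set S) (C : set Xi) :
  measurable B -> measurable C ->
  P (x k @^-1` B `&` xi k @^-1` C) = (P (x k @^-1` B) * law C)%E.
Proof.
move=> mB mC; have := @process_cylinder k [fset k]%fset (fun=> C) B.
rewrite big_seq_fset1 set_fset1 bigcap_set1; apply => //.
by move=> i; rewrite inE => /eqP ->.
Qed.

End independence.

(** * Integration against an independent variable *)

Section joint_law.
Context {d d' ds : measure_display} {Omega : measurableType d}
  {Xi : measurableType d'} {S : measurableType ds} {R : realType}.
Variables (P : probability Omega R) (law : probability Xi R).
Variables (X : {mfun Omega >-> S}) (Z : {mfun Omega >-> Xi}).
Hypothesis XZ_indep : forall (B : set S) (C : set Xi),
  measurable B -> measurable C ->
  P (X @^-1` B `&` Z @^-1` C) = (P (X @^-1` B) * law C)%E.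
Local Open Scope ereal_scope.

Let XZ w := (X w, Z w).

Let mXZ : measurable_fun [set: Omega] XZ.
Proof. exact: measurable_fun_pair. Qed.

(** Tonelli's theorem for the joint law of independent variables. *)
Lemma ge0_integral_indep (F : S * Xi -> \bar R) :
  measurable_fun [set: S * Xi] F -> (forall sz, 0 <= F sz) ->
  \int[P]_w F (X w, Z w) = \int[distribution P X]_s \int[law]_z F (s, z).
Proof.
move=> mF F0.
rewrite -(fubini_tonelli1 F)// -[LHS](@ge0_integral_pushforward _ _ _ _ _ _ mXZ P setT)//.
apply: eq_measure_integral => A mA _; apply/esym.
by apply: product_measure_unique => // B C mB mC; exact: XZ_indep.
Qed.

Lemma integrable_indep (F : S * Xi -> \bar R) :
  measurable_fun [set: S * Xi] F ->
  P.-integrable setT (fun w => F (X w, Z w)) ->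
  (distribution P X \x law).-integrable setT F.
Proof.
move=> mF /integrableP[_ iF]; apply/integrable12ltyP => //.
have mF' : measurable_fun setT (abse \o F) by exact: measurableT_comp.
by have := ge0_integral_indep mF' (fun=> abse_ge0 _) => /= <-.
Qed.

Lemma integrable_distribution (h : S -> \bar R) :
  measurable_fun [set: S] h -> (distribution P X).-integrable setT h ->
  P.-integrable setT (h \o X).
Proof.
move=> mh /integrableP[_ ih]; apply/integrableP; split.
  exact: measurableT_comp.
by move: ih; rewrite ge0_integral_distribution//; exact: measurableT_comp.
Qed.

(** Fubini's theorem for the joint law of independent variables: the noise can
    be integrated first, with the state frozen. *)
Lemma integral_indep (F : S * Xi -> \bar R) :
  measurable_fun [set: S * Xi] F ->
  P.-integrable setT (fun w => F (X w, Z w)) ->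
  [/\ measurable_fun [set: S] (fun s => \int[law]_z F (s, z)),
      P.-integrable setT (fun w => \int[law]_z F (X w, z)) &
      \int[P]_w F (X w, Z w) = \int[P]_w \int[law]_z F (X w, z)].
Proof.
move=> mF iF; have iF2 := integrable_indep mF iF.
have mI := measurable_fubini_F iF2.
have iI := integrable_fubini_F iF2.
have iIX := integrable_distribution mI iI.
split => //.
transitivity (\int[distribution P X]_s \int[law]_z F (s, z)); last first.
  exact: integral_distribution.
rewrite integral12_prod_meas1//.
rewrite -[LHS](@integral_pushforward _ _ _ _ _ _ mXZ P setT)//.
apply: eq_measure_integral => A mA _; apply/esym.
by apply: product_measure_unique => // B C mB mC; exact: XZ_indep.
Qed.

End joint_law.

(** * The stochastic oracle *)

Lemma integral_cst_probability d (T : measurableType d) (R : realType)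
    (P : probability T R) (r : R) : (\int[P]_x r%:E = r%:E)%E.
Proof.
rewrite integral_cst//.
exact: (etrans (congr1 (mule r%:E) (probability_setT P)) (mule1 _)).
Qed.

Section stochastic_oracle.
Context {R : realType} {n : nat}.
Variables (nrm : 'rV[R]_n -> R) (nrm_norm : is_norm nrm).
Context {d' : measure_display} {Xi : measurableType d'}.
Variables (law : probability Xi R) (G : 'rV[R]_n -> Xi -> 'cV[R]_n).
Hypothesis G_measurable : forall j : 'I_n,
  measurable_fun [set: borelType 'rV[R]_n * Xi]
    (fun xz : borelType 'rV[R]_n * Xi => G xz.1 xz.2 j ord0).
Variable (sigma : R).
Hypothesis G_moment : forall x,
  (\int[law]_z (dual_norm nrm (G x z) ^+ 2)%:E <= (sigma ^+ 2)%:E)%E.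
Variables (b : 'rV[R]_n -> 'cV[R]_n) (Delta : 'rV[R]_n -> Xi -> 'cV[R]_n).
(* [b] is the mean of the oracle and [Delta] its centred noise *)
Hypothesis G_def : forall x z, G x z = b x + Delta x z.
Hypothesis Delta_mean0 : forall x (j : 'I_n),
  (\int[law]_z (Delta x z j ord0)%:E = 0)%E.

Lemma oracle_measurable :
  measurable_fun [set: borelType 'rV[R]_n * Xi]
    ((fun xz => G xz.1 xz.2) : borelType 'rV[R]_n * Xi -> borelType 'cV[R]_n).
Proof. by apply: measurable_fun_mx => i j; rewrite ord1; exact: G_measurable. Qed.

Lemma measurable_dual_norm_oracle :
  measurable_fun [set: borelType 'rV[R]_n * Xi]
    (fun xz : borelType 'rV[R]_n * Xi => dual_norm nrm (G xz.1 xz.2)).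
Proof.
apply: (@measurableT_comp _ _ _ _ _ _
  (dual_norm nrm : borelType 'cV[R]_n -> R)); last exact: oracle_measurable.
by apply: continuous_borel_measurable_real; exact: dual_norm_continuous.
Qed.

Lemma measurable_coord (i : 'I_n) :
  measurable_fun [set: borelType 'rV[R]_n]
    ((fun x : 'rV[R]_n => x ord0 i) : borelType 'rV[R]_n -> R).
Proof. by apply: continuous_borel_measurable_real; exact: coord_continuous. Qed.

Lemma measurable_pairing_oracle (z : 'rV[R]_n) :
  measurable_fun [set: borelType 'rV[R]_n * Xi]
    (fun xz : borelType 'rV[R]_n * Xi => pairing (G xz.1 xz.2) ((xz.1 : 'rV[R]_n) - z)).
Proof.
rewrite (_ : (fun xz => _) = (fun xz : borelType 'rV[R]_n * Xi =>
  \sum_i ((xz.1 : 'rV[R]_n) ord0 i - z ord0 i) * G xz.1 xz.2 i ord0)); last first.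
  by apply/funext => xz; rewrite pairingE; apply: eq_bigr => i _; rewrite !mxE.
apply: measurable_sum => i; apply: measurable_funM; last exact: G_measurable.
apply: measurable_funB; last exact: measurable_cst.
exact: (measurableT_comp (measurable_coord i)).
Qed.

Lemma oracle_coord_integrable x (j : 'I_n) :
  law.-integrable setT (fun z => (G x z j ord0)%:E).
Proof.
have mG : measurable_fun setT (fun z => G x z j ord0).
  exact: (measurableT_comp (G_measurable j) (pair1_measurable (x : borelType 'rV[R]_n))).
have mD : measurable_fun setT (fun z => dual_norm nrm (G x z)).
  exact: (measurableT_comp measurable_dual_norm_oracle (pair1_measurable (x : borelType 'rV[R]_n))).
apply/integrableP; split; first exact/measurable_EFinP.
pose c := nrm (delta_mx ord0 j).
have c0 : 0 <= c by exact: nrm_ge0.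
apply: (@le_lt_trans _ _ (\int[law]_z ((1 + dual_norm nrm (G x z) ^+ 2) * c)%:E)%E).
  apply: ge0_le_integral => //.
  - by apply: measurableT_comp => //; exact/measurable_EFinP.
  - apply/measurable_EFinP/measurable_funM => //.
    by apply: measurable_funD => //; exact: measurable_funX.
  - move=> z _; rewrite lee_fin (le_trans (coord_le_dual nrm_norm _ _))//.
    rewrite ler_wpM2r//; set a := dual_norm _ _.
    have : 0 <= (a - 1) ^+ 2 by exact: sqr_ge0.
    have : 0 <= a ^+ 2 by exact: sqr_ge0.
    by rewrite sqrrB1; lra.
under eq_integral do rewrite EFinM muleC.
rewrite ge0_integralZl//; last 2 first.
- apply/measurable_EFinP; apply: measurable_funD => //; exact: measurable_funX.
- by move=> z _; rewrite lee_fin addr_ge0 ?sqr_ge0.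
apply: lte_mul_pinfty => //.
under eq_integral do rewrite EFinD.
rewrite ge0_integralD//; last 2 first.
- by move=> z _; rewrite lee_fin sqr_ge0.
- by apply/measurable_EFinP; exact: measurable_funX.
rewrite integral_cst_probability; apply: lte_add_pinfty; first exact: ltry.
by rewrite (le_lt_trans (G_moment x)) ?ltry.
Qed.

Lemma oracle_mean x (j : 'I_n) :
  (\int[law]_z (G x z j ord0)%:E = (b x j ord0)%:E)%E.
Proof.
have DE z : (Delta x z j ord0)%:E = ((G x z j ord0)%:E - (b x j ord0)%:E)%E.
  by rewrite G_def -EFinB mxE addrAC subrr add0r.
have := Delta_mean0 x j; under eq_integral do rewrite DE.
rewrite integralB//; [|exact: oracle_coord_integrable|exact: finite_measure_integrable_cst].
rewrite integral_cst_probability.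
have := integrable_fin_num measurableT (oracle_coord_integrable x j).
case: (integral _ _ _) => [r| |]//= _; rewrite -EFinB => -[] /eqP.
by rewrite subr_eq0 => /eqP ->.
Qed.

Lemma oracle_pairing_mean x v :
  (\int[law]_z (pairing (G x z) v)%:E = (pairing (b x) v)%:E)%E.
Proof.
under eq_integral do rewrite pairingE -sumEFin.
rewrite integral_sum//; last first.
  move=> i; under eq_fun do rewrite EFinM.
  exact/integrableZl/oracle_coord_integrable.
rewrite pairingE -sumEFin; apply: eq_bigr => i _.
under eq_integral do rewrite EFinM.
by rewrite integralZl ?oracle_mean//; exact: oracle_coord_integrable.
Qed.

Context {d : measure_display} {Omega : measurableType d}.
Variable P : probability Omega R.
Variables (X : {mfun Omega >-> borelType 'rV[R]_n}) (Z : {mfun Omega >-> Xi}).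
Hypothesis XZ_indep : forall (B : set (borelType 'rV[R]_n)) (C : set Xi),
  measurable B -> measurable C ->
  P (X @^-1` B `&` Z @^-1` C) = (P (X @^-1` B) * law C)%E.

(** The second moment bound at deterministic points transfers to a random point
    independent of the noise. *)
Lemma oracle_second_moment :
  (\int[P]_w (dual_norm nrm (G (X w) (Z w)) ^+ 2)%:E <= (sigma ^+ 2)%:E)%E.
Proof.
pose F (xz : borelType 'rV[R]_n * Xi) := (dual_norm nrm (G xz.1 xz.2) ^+ 2)%:E.
have mF : measurable_fun setT F.
  by apply/measurable_EFinP; apply: measurable_funX; exact: measurable_dual_norm_oracle.
have F0 xz : (0 <= F xz)%E by rewrite lee_fin sqr_ge0.
rewrite (ge0_integral_indep XZ_indep mF F0).
apply: (@le_trans _ _ (\int[distribution P X]_s (sigma ^+ 2)%:E)%E).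
  apply: ge0_le_integral => //.
  - by move=> s _; exact: integral_ge0.
  - exact: measurable_fun_fubini_tonelli_F.
  - by move=> s _; exact: G_moment.
by rewrite integral_cst_probability.
Qed.

Lemma integrable_oracle_second_moment :
  P.-integrable setT (fun w => (dual_norm nrm (G (X w) (Z w)) ^+ 2)%:E).
Proof.
apply/integrableP; split.
  apply/measurable_EFinP; apply: measurable_funX.
  exact: (measurableT_comp measurable_dual_norm_oracle
    (measurable_fun_pair (measurable_funP X) (measurable_funP Z))).
under eq_integral do rewrite gee0_abs ?lee_fin ?sqr_ge0//.
by rewrite (le_lt_trans oracle_second_moment) ?ltry.
Qed.

Variable xstar : 'rV[R]_n.
Hypothesis X_second_moment :
  P.-integrable setT (fun w => (nrm ((X w : 'rV[R]_n) - xstar) ^+ 2)%:E).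

Lemma integrable_pairing_oracle :
  P.-integrable setT (fun w => (pairing (G (X w) (Z w)) ((X w : 'rV[R]_n) - xstar))%:E).
Proof.
apply: (le_integrable _ _ _ (integrableD _ integrable_oracle_second_moment X_second_moment)) => //.
  apply/measurable_EFinP.
  exact: (measurableT_comp (measurable_pairing_oracle xstar)
    (measurable_fun_pair (measurable_funP X) (measurable_funP Z))).
move=> w _; rewrite -EFinD !abse_EFin lee_fin.
rewrite (le_trans (pairing_abs_le_dual nrm_norm _ _))//.
set u := dual_norm _ _; set v := nrm _.
rewrite ger0_norm ?addr_ge0 ?sqr_ge0//.
have : 0 <= (u - v) ^+ 2 by exact: sqr_ge0.
have : 0 <= u ^+ 2 + v ^+ 2 by rewrite addr_ge0 ?sqr_ge0.
by rewrite sqrrB; lra.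
Qed.

(** The noise does not contribute to the expected descent: given the state, the
    oracle averages to [b]. *)
Lemma integral_pairing_oracle :
  [/\ measurable_fun [set: borelType 'rV[R]_n]
        ((fun x => pairing (b x) (x - xstar)) : borelType 'rV[R]_n -> R),
      P.-integrable setT (fun w => (pairing (b (X w)) ((X w : 'rV[R]_n) - xstar))%:E) &
      (\int[P]_w (pairing (G (X w) (Z w)) ((X w : 'rV[R]_n) - xstar))%:E
       = \int[P]_w (pairing (b (X w)) ((X w : 'rV[R]_n) - xstar))%:E)%E].
Proof.
pose F (xz : borelType 'rV[R]_n * Xi) :=
  (pairing (G xz.1 xz.2) ((xz.1 : 'rV[R]_n) - xstar))%:E.
have mF : measurable_fun setT F.
  by apply/measurable_EFinP; exact: measurable_pairing_oracle.
have [m i e] := integral_indep XZ_indep mF integrable_pairing_oracle.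
have FE (s : 'rV[R]_n) : (\int[law]_z F (s, z) = (pairing (b s) (s - xstar))%:E)%E.
  exact: (oracle_pairing_mean s (s - xstar)).
split.
- by apply/measurable_EFinP; move: m; under eq_fun do rewrite FE.
- by move: i; under eq_fun do rewrite FE.
- by rewrite [LHS]e; apply: eq_integral => w _; rewrite FE.
Qed.


End stochastic_oracle.

(** * One step in expectation *)

(** The arithmetic of [expected_descent]: [v], [v'] are the expected divergences
    before and after the step, [m] the expected inner product, [q] the expected
    squared dual norm and [f] the expected gap. *)
Lemma descent_arithmetic (R : realType) (s C c r : R) (v v' m q f : \bar R) :
  0 <= s -> 0 <= c ->
  v \is a fin_num -> v' \is a fin_num -> m \is a fin_num -> q \is a fin_num ->
  (0 <= f)%E -> (f <= m + C%:E)%E ->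
  (v' <= v - s%:E * m + c%:E * q)%E -> (q <= r%:E)%E ->
  (s%:E * f + v' <= v + (c * r + s * C)%:E)%E.
Proof.
move=> s0 c0; case: v v' m q f => [v| |] [v'| |] [m| |] [q| |] [f| |] //= _ _ _ _.
rewrite -!(EFinM, EFinD, EFinB) !lee_fin => f0 fm v'v qr.
have := ler_wpM2l s0 fm; have := ler_wpM2l c0 qr; rewrite mulrDr; lra.
Qed.

Section expected_descent.
Context {R : realType} {n : nat}.
Variables (nrm : 'rV[R]_n -> R) (nrm_norm : is_norm nrm).
Variables (alpha : R) (psi : 'rV[R]_n -> R).
Hypotheses (alpha_gt0 : 0 < alpha) (psi_mirror : mirror_potential nrm alpha psi).

Lemma measurable_pairing d (T : measurableType d)
    (p : T -> 'cV[R]_n) (v : T -> 'rV[R]_n) :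
  (forall i, measurable_fun [set: T] (fun w => p w i ord0)) ->
  (forall i, measurable_fun [set: T] (fun w => v w ord0 i)) ->
  measurable_fun [set: T] (fun w => pairing (p w) (v w)).
Proof.
move=> mp mv; under eq_fun do rewrite pairingE.
by apply: measurable_sum => i; exact: measurable_funM.
Qed.

Lemma measurable_gradient_coord (i : 'I_n) :
  measurable_fun [set: borelType 'rV[R]_n]
    ((fun y => gradient psi y i ord0) : borelType 'rV[R]_n -> R).
Proof.
have cg : continuous (fun y : 'rV[R]_n => gradient psi y i ord0).
  move=> y; apply: (@continuous_comp _ _ _ (gradient psi) (fun A => A i ord0)).
    exact: (mirror_continuous_gradient psi_mirror).
  exact: coord_continuous.
exact: (continuous_borel_measurable_real cg).
Qed.

Lemma measurable_bregman (z : 'rV[R]_n) :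
  measurable_fun [set: borelType 'rV[R]_n]
    ((fun y => bregman psi z y) : borelType 'rV[R]_n -> R).
Proof.
apply: measurable_funB.
  apply: measurable_funB; first exact: measurable_cst.
  exact: (continuous_borel_measurable_real (mirror_continuous psi_mirror)).
apply: (@measurable_pairing _ (borelType 'rV[R]_n) (gradient psi) (fun y => z - y)) => i.
  exact: measurable_gradient_coord.
under eq_fun do rewrite !mxE.
by apply: measurable_funB; [exact: measurable_cst | exact: measurable_coord].
Qed.

Context {d' : measure_display} {Xi : measurableType d'}.
Variables (law : probability Xi R) (G : 'rV[R]_n -> Xi -> 'cV[R]_n).
Hypothesis G_measurable : forall j : 'I_n,
  measurable_fun [set: borelType 'rV[R]_n * Xi]
    (fun xz : borelType 'rV[R]_n * Xi => G xz.1 xz.2 j ord0).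

Lemma measurable_mirror_update (s : R) :
  measurable_fun [set: borelType 'rV[R]_n * Xi]
    ((fun xz => gradient_conjugate psi (gradient psi xz.1 - s *: G xz.1 xz.2))
     : borelType 'rV[R]_n * Xi -> borelType 'rV[R]_n).
Proof.
apply: (@measurableT_comp _ _ _ _ _ _
  (gradient_conjugate psi : borelType 'cV[R]_n -> borelType 'rV[R]_n)).
  exact: (continuous_borel_measurable
    (mirror_gradient_conjugate_continuous nrm_norm alpha_gt0 psi_mirror)).
apply: measurable_fun_mx => i j; rewrite ord1.
rewrite (_ : (fun w => _) = (fun xz : borelType 'rV[R]_n * Xi =>
    gradient psi xz.1 i ord0 - s * G xz.1 xz.2 i ord0)); last first.
  by apply/funext => xz; rewrite mxE [X in _ + X]mxE [X in _ - X]mxE.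
apply: measurable_funB; last by apply: measurable_funM.
exact: (measurableT_comp (measurable_gradient_coord i) measurable_fst).
Qed.

Variable (sigma : R).
Hypothesis G_moment : forall x,
  (\int[law]_z (dual_norm nrm (G x z) ^+ 2)%:E <= (sigma ^+ 2)%:E)%E.
Variables (b : 'rV[R]_n -> 'cV[R]_n) (Delta : 'rV[R]_n -> Xi -> 'cV[R]_n).
Hypothesis G_def : forall x z, G x z = b x + Delta x z.
Hypothesis Delta_mean0 : forall x (j : 'I_n),
  (\int[law]_z (Delta x z j ord0)%:E = 0)%E.

Context {d : measure_display} {Omega : measurableType d}.
Variable P : probability Omega R.
Variables (X : {mfun Omega >-> borelType 'rV[R]_n}) (Z : {mfun Omega >-> Xi}).
Hypothesis XZ_indep : forall (B : set (borelType 'rV[R]_n)) (C : set Xi),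
  measurable B -> measurable C ->
  P (X @^-1` B `&` Z @^-1` C) = (P (X @^-1` B) * law C)%E.
Variable xstar : 'rV[R]_n.
Local Notation V := (fun y => bregman psi xstar y).

Lemma integrable_nrm_bregman :
  P.-integrable setT (fun w => (V (X w))%:E) ->
  P.-integrable setT (fun w => (nrm ((X w : 'rV[R]_n) - xstar) ^+ 2)%:E).
Proof.
move=> iV; apply: (le_integrable _ _ _ (integrableZl measurableT (2 / alpha) iV)) => //.
  apply/measurable_EFinP; apply: measurable_funX.
  have mn : measurable_fun [set: borelType 'rV[R]_n]
      ((fun y : 'rV[R]_n => nrm (y - xstar)) : borelType 'rV[R]_n -> R).
    have cn : continuous (fun y : 'rV[R]_n => nrm (y - xstar)).
      have [M _ nM] := nrm_le_norm nrm_norm.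
      apply: (@lipschitz_bound_continuous _ _ _ _ M) => u v.
      rewrite (le_trans (nrm_dist nrm_norm _ _))//.
      by rewrite opprB addrA subrK nM.
    exact: (continuous_borel_measurable_real cn).
  exact: (measurableT_comp mn (measurable_funP X)).
move=> w _; rewrite -EFinM !abse_EFin lee_fin.
have v0 := bregman_ge0 alpha_gt0 psi_mirror xstar (X w).
have a0 : 0 <= 2 / alpha by rewrite divr_ge0// ltW.
rewrite (ger0_norm (sqr_ge0 _)) (ger0_norm (mulr_ge0 a0 v0)).
rewrite [leRHS]mulrAC ler_pdivlMr//.
have := bregman_ge psi_mirror xstar (X w).
rewrite -(opprB (X w : 'rV[R]_n) xstar) (nrmN nrm_norm).
set u := nrm _ ^+ 2; set v := bregman _ _ _; lra.
Qed.

(** One step of the method in expectation; [F] bounds the suboptimality of the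
    current point and [C] is the price of the deterministic error. *)
Lemma expected_descent (s C : R) (X' : Omega -> 'rV[R]_n) (F : Omega -> R) :
  0 <= s ->
  (forall w, X' w =
    gradient_conjugate psi (gradient psi (X w) - s *: G (X w) (Z w))) ->
  P.-integrable setT (fun w => (V (X w))%:E) ->
  measurable_fun [set: Omega] F -> (forall w, 0 <= F w) ->
  {ae P, forall w, F w <= pairing (b (X w)) ((X w : 'rV[R]_n) - xstar) + C} ->
  P.-integrable setT (fun w => (V (X' w))%:E) /\
  (s%:E * \int[P]_w (F w)%:E + \int[P]_w (V (X' w))%:E
   <= \int[P]_w (V (X w))%:E
      + (s ^+ 2 * (sigma ^+ 2 / (2 * alpha)) + s * C)%:E)%E.
Proof.
move=> s0 X'E iV mF F0 aeF.
have iN := integrable_nrm_bregman iV.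
have iS := integrable_pairing_oracle nrm_norm G_measurable G_moment XZ_indep iN.
have iD := integrable_oracle_second_moment nrm_norm G_measurable G_moment XZ_indep.
have leD := oracle_second_moment nrm_norm G_measurable G_moment XZ_indep.
have [mm im ES] := integral_pairing_oracle nrm_norm G_measurable G_moment G_def
  Delta_mean0 XZ_indep iN.
set m := (fun w => pairing (b (X w)) ((X w : 'rV[R]_n) - xstar)) in im ES.
set S := (fun w => pairing (G (X w) (Z w)) ((X w : 'rV[R]_n) - xstar)) in iS ES.
set D2 := (fun w => dual_norm nrm (G (X w) (Z w)) ^+ 2) in iD leD.
have mX' : measurable_fun [set: Omega] (X' : Omega -> borelType 'rV[R]_n).
  rewrite (_ : X' = (fun xz : borelType 'rV[R]_n * Xi => gradient_conjugate psi
    (gradient psi xz.1 - s *: G xz.1 xz.2)) \o (fun w => (X w, Z w))).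
    exact: (measurableT_comp (measurable_mirror_update s)
      (measurable_fun_pair (measurable_funP X) (measurable_funP Z))).
  by apply/funext => w; rewrite X'E.
have mV' : measurable_fun [set: Omega] (fun w => V (X' w)).
  exact: (measurableT_comp (measurable_bregman xstar) mX').
have V'0 w : 0 <= V (X' w) by exact: (bregman_ge0 alpha_gt0 psi_mirror).
pose c := s ^+ 2 / (2 * alpha).
have c0 : 0 <= c by rewrite divr_ge0 ?sqr_ge0// mulr_ge0// ltW.
pose H w := ((V (X w))%:E - s%:E * (S w)%:E + c%:E * (D2 w)%:E)%E.
have iS' := integrableZl measurableT s iS.
have iD' := integrableZl measurableT c iD.
have iVS : P.-integrable setT (fun w => (V (X w))%:E - s%:E * (S w)%:E)%E.
  exact: integrableB.
have iH : P.-integrable setT H.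
  exact: integrableD.
have step w : V (X' w) <= V (X w) - s * S w + c * D2 w.
  have -> : c * D2 w = s ^+ 2 * (D2 w / (2 * alpha)) by rewrite /c mulrAC mulrA.
  by rewrite addrAC lerBrDr X'E; exact: mirror_descent_step.
have iV' : P.-integrable setT (fun w => (V (X' w))%:E).
  apply: (le_integrable _ _ _ iH) => //; first exact/measurable_EFinP.
  move=> w _; rewrite /H -!EFinM -EFinB -EFinD !abse_EFin lee_fin ger0_norm//.
  exact: le_trans (step w) (ler_norm _).
split => //.
have leV' : (\int[P]_w (V (X' w))%:E <= \int[P]_w H w)%E.
  apply: le_integral => // w _.
  by rewrite /H -!EFinM -EFinB -EFinD lee_fin.
have EH : (\int[P]_w H w = \int[P]_w (V (X w))%:E - s%:E * \int[P]_w (m w)%:E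
    + c%:E * \int[P]_w (D2 w)%:E)%E.
  apply: (etrans (integralD measurableT iVS iD')).
  rewrite -ES -(integralZl measurableT iS s) -(integralZl measurableT iD c).
  by congr (_ + _)%E; exact: (integralB measurableT iV iS').
have leF : (\int[P]_w (F w)%:E <= \int[P]_w (m w)%:E + C%:E)%E.
  have imC : P.-integrable setT (fun w => (m w)%:E + C%:E)%E.
    by apply: integrableD => //; exact: finite_measure_integrable_cst.
  have mmC : measurable_fun [set: Omega] (fun w => ((m w)%:E + C%:E)%E).
    exact: measurable_int imC.
  have <- : (\int[P]_w ((m w)%:E + C%:E) = \int[P]_w (m w)%:E + C%:E)%E.
    rewrite integralD//; last exact: finite_measure_integrable_cst.
    by rewrite integral_cst_probability.
  have mM : measurable_fun [set: Omega] (fun w => maxe 0%E ((m w)%:E + C%:E)%E).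
    by apply: measurable_maxe => //; exact: measurable_cst.
  (* the right-hand side is only almost surely nonnegative *)
  apply: (@le_trans _ _ (\int[P]_w maxe 0%E ((m w)%:E + C%:E))%E).
    apply: ae_ge0_le_integral => //.
    - by move=> w _; rewrite lee_fin.
    - exact/measurable_EFinP.
    - by move=> w _; rewrite le_max lexx.
    - by apply: filterS aeF => w Fw _; rewrite le_max -EFinD !lee_fin Fw orbT.
  rewrite le_eqVlt; apply/orP; left; apply/eqP; apply: ae_eq_integral => //.
  apply: filterS aeF => w Fw _; apply/max_idPr.
  by rewrite -EFinD lee_fin (le_trans (F0 w)).
have fV := integrable_fin_num measurableT iV.
have fV' := integrable_fin_num measurableT iV'.
have fm := integrable_fin_num measurableT im.
have fD := integrable_fin_num measurableT iD.
have F0' : (0 <= \int[P]_w (F w)%:E)%E by apply: integral_ge0 => w _; rewrite lee_fin.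
have -> : s ^+ 2 * (sigma ^+ 2 / (2 * alpha)) = c * sigma ^+ 2.
  by rewrite /c [RHS]mulrAC mulrA.
rewrite EH in leV'.
exact: (descent_arithmetic s0 c0 fV fV' fm fD F0' leF leV' leD).
Qed.

End expected_descent.

(** * Telescoping and ergodic averages *)

Section convergence.
Context {R : realType} {n : nat}.
Variables (nrm : 'rV[R]_n -> R) (nrm_norm : is_norm nrm).
Variables (f : 'rV[R]_n -> \bar R) (g : 'rV[R]_n -> 'cV[R]_n) (xstar : 'rV[R]_n).
Hypotheses (f_proper : proper_function f) (f_lsc : lower_semicontinuous f).
Hypotheses (g_sub : forall x, subdifferential f x (g x)).
Hypothesis xstar_min : forall x, (f xstar <= f x)%E.

(** A proper function with a subgradient at every point is finite. *)
Lemma subdifferentiable_fin_num x : f x \is a fin_num.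
Proof.
have [fNy [y fy]] := f_proper.
rewrite fin_numE fNy/=; have := g_sub x y.
by case: (f x) (fNy x) fy => //; case: (f y).
Qed.

(** The suboptimality of [x], as a real number. *)
Definition gap x : R := fine (f x) - fine (f xstar).

Lemma gapE x : (f x - f xstar)%E = (gap x)%:E.
Proof. by rewrite /gap EFinB !fineK// subdifferentiable_fin_num. Qed.

Lemma gap_ge0 x : 0 <= gap x.
Proof. by rewrite subr_ge0 fine_le ?subdifferentiable_fin_num. Qed.

Lemma gap_subgradient x y : gap x + pairing (g x) (y - x) <= gap y.
Proof.
have := g_sub x y; rewrite /gap -(fineK (subdifferentiable_fin_num x)).
by rewrite -(fineK (subdifferentiable_fin_num y)) -EFinD lee_fin /=; lra.
Qed.

Lemma measurable_gap :
  measurable_fun [set: borelType 'rV[R]_n] (gap : borelType 'rV[R]_n -> R).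
Proof.
apply: measurable_funB; last exact: measurable_cst.
exact: (measurableT_comp (fine_measurable measurableT)
  (lower_semicontinuous_borel_measurable f_lsc)).
Qed.

Lemma pairing_sum (p : 'cV[R]_n) I (s : seq I) (F : I -> 'rV[R]_n) :
  pairing p (\sum_(i <- s) F i) = \sum_(i <- s) pairing p (F i).
Proof. by rewrite /pairing mulmx_suml summxE. Qed.

(** Jensen's inequality, read off the subgradient at the average. *)
Lemma gap_ergodic_average (t : nat -> R) (x : nat -> 'rV[R]_n) k :
  (forall i, 0 < t i) ->
  gap (ergodic_average t x k)
  <= (\sum_(i < k.+1) t i)^-1 * \sum_(i < k.+1) t i * gap (x i).
Proof.
move=> t0; set a := ergodic_average t x k; set T := \sum_(i < k.+1) t i.
have T0 : 0 < T.
  rewrite /T big_ord_recl ltr_pwDl// sumr_ge0// => i _; exact/ltW.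
rewrite mulrC ler_pdivlMr//.
have aE : \sum_(i < k.+1) t i *: x i = T *: a.
  rewrite /a /ergodic_average scaler_sumr; apply: eq_bigr => i _.
  by rewrite scalerA mulrCA mulfV ?mulr1// gt_eqF.
apply: (@le_trans _ _ (\sum_(i < k.+1) t i * (gap a + pairing (g a) (x i - a)))).
  rewrite le_eqVlt; apply/orP; left; apply/eqP.
  under eq_bigr do rewrite mulrDr.
  rewrite big_split/= -mulr_suml -/T mulrC -[LHS]addr0; congr (_ + _).
  under eq_bigr do rewrite -pairingZr scalerBr.
  rewrite -pairing_sum sumrB aE -scaler_suml -/T subrr.
  by rewrite /pairing mul0mx mxE.
by apply: ler_sum => i _; rewrite ler_pM2l// gap_subgradient.
Qed.

Lemma gap_min : gap xstar = 0.
Proof. by rewrite /gap subrr. Qed.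

Lemma gap_le_bounded_error (x : 'rV[R]_n) (u : 'cV[R]_n) (C : R) :
  `|pairing u (x - xstar)| <= C ->
  gap x <= pairing (g x + u) (x - xstar) + C.
Proof.
move=> uC; have := gap_subgradient x xstar; rewrite gap_min.
rewrite -(opprB x xstar) pairingNr pairingDl.
by move: uC; rewrite ler_norml => /andP[+ _]; lra.
Qed.

Lemma gap_le_strongly_convex (mu C : R) (x : 'rV[R]_n) (u : 'cV[R]_n) :
  0 < mu -> strongly_convex nrm mu f g -> dual_norm nrm u ^+ 2 <= C ->
  gap x <= pairing (g x + u) (x - xstar) + C / (2 * mu).
Proof.
move=> mu0 fsc uC.
have : gap x + (pairing (g x) (xstar - x) + mu / 2 * nrm (xstar - x) ^+ 2) <= 0.
  have := fsc x xstar; rewrite /gap -(fineK (subdifferentiable_fin_num x)).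
  rewrite -(fineK (subdifferentiable_fin_num xstar)) -EFinD lee_fin /=; lra.
rewrite -(opprB x xstar) (nrmN nrm_norm) pairingNr pairingDl.
have := pairing_abs_le_dual nrm_norm u (x - xstar).
rewrite ler_norml => /andP[+ _].
have := mul_le_sqr_div (dual_norm nrm u) (nrm (x - xstar)) mu0.
have : dual_norm nrm u ^+ 2 / (2 * mu) <= C / (2 * mu).
  by rewrite ler_pM2r// invr_gt0 mulr_gt0.
lra.
Qed.

Variables (alpha : R) (psi : 'rV[R]_n -> R).
Hypotheses (alpha_gt0 : 0 < alpha) (psi_mirror : mirror_potential nrm alpha psi).
Context {d d' : measure_display} {Omega : measurableType d}
  {Xi : measurableType d'}.
Variables (P : probability Omega R) (law : probability Xi R).
Variables (xi : nat -> {RV P >-> Xi}) (xi_iid : iid law xi).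
Variables (Delta : 'rV[R]_n -> Xi -> 'cV[R]_n) (U : 'rV[R]_n -> 'cV[R]_n).
Variable G : 'rV[R]_n -> Xi -> 'cV[R]_n.
Hypothesis G_def : forall x z, G x z = g x + Delta x z + U x.
Hypothesis G_measurable : forall j : 'I_n,
  measurable_fun [set: borelType 'rV[R]_n * Xi]
    (fun xz : borelType 'rV[R]_n * Xi => G xz.1 xz.2 j ord0).
Hypothesis Delta_mean0 : forall x (j : 'I_n),
  (\int[law]_z (Delta x z j ord0)%:E = 0)%E.
Variable sigma : R.
Hypothesis G_moment : forall x,
  (\int[law]_z (dual_norm nrm (G x z) ^+ 2)%:E <= (sigma ^+ 2)%:E)%E.
Variables (t : nat -> R) (t_gt0 : forall k, 0 < t k).
Variables (x0 : 'rV[R]_n) (x : nat -> Omega -> 'rV[R]_n).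
Hypothesis x_init : forall w, x 0%N w = x0.
Hypothesis x_step : forall k w, x k.+1 w =
  gradient_conjugate psi (gradient psi (x k w) - t k *: G (x k w) (xi k w)).

Let Phi k (xz : borelType 'rV[R]_n * Xi) : borelType 'rV[R]_n :=
  gradient_conjugate psi (gradient psi xz.1 - t k *: G xz.1 xz.2).

Let mPhi k : measurable_fun [set: borelType 'rV[R]_n * Xi] (Phi k).
Proof. exact: (measurable_mirror_update nrm_norm alpha_gt0 psi_mirror G_measurable). Qed.

Lemma iterate_measurable k :
  measurable_fun [set: Omega] (x k : Omega -> borelType 'rV[R]_n).
Proof.
exact: (@process_measurable _ _ _ _ _ (borelType 'rV[R]_n) _ _ xi Phi x x0).
Qed.

Lemma iterate_independent k (B : set (borelType 'rV[R]_n)) (C : set Xi) :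
  measurable B -> measurable C ->
  P (x k @^-1` B `&` xi k @^-1` C) = (P (x k @^-1` B) * law C)%E.
Proof.
exact: (@process_independent _ _ _ _ _ (borelType 'rV[R]_n) _ _ _ xi xi_iid Phi x x0).
Qed.

Let X k : {mfun Omega >-> borelType 'rV[R]_n} :=
  HB.pack (x k : Omega -> borelType 'rV[R]_n)
    (isMeasurableFun.Build _ _ _ _ _ (iterate_measurable k)).

Lemma measurable_gap_iterate k : measurable_fun [set: Omega] (fun w => gap (x k w)).
Proof. exact: (measurableT_comp measurable_gap (iterate_measurable k)). Qed.

(* The deterministic error enters only through the bound [K] on its price per
   step. *)
Variable K : R.
Hypothesis gap_bound : forall i, {ae P, forall w,
  gap (x i w) <= pairing (g (x i w) + U (x i w)) (x i w - xstar) + K}.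

(** The one-step inequality, telescoped; integrability of the divergence is
    part of the induction. *)
Lemma iterate_descent k :
  P.-integrable setT (fun w => (bregman psi xstar (x k w))%:E) /\
  (\sum_(i < k) (t i)%:E * \int[P]_w (gap (x i w))%:E
    + \int[P]_w (bregman psi xstar (x k w))%:E
   <= (bregman psi xstar x0
       + \sum_(i < k) (t i ^+ 2 * (sigma ^+ 2 / (2 * alpha)) + t i * K))%:E)%E.
Proof.
elim: k => [|k [iV IH]].
  rewrite (_ : (fun w => _) = cst (bregman psi xstar x0)%:E); last first.
    by apply/funext => w; rewrite x_init.
  split; first exact: finite_measure_integrable_cst.
  by rewrite !big_ord0 add0e addr0 integral_cst_probability.
have GbD y z : G y z = (g y + U y) + Delta y z by rewrite G_def addrAC.
have [iV' le'] := expected_descent nrm_norm alpha_gt0 psi_mirror G_measurable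
  G_moment GbD Delta_mean0 (X := X k) (iterate_independent k) (ltW (t_gt0 k))
  (x_step k) iV (measurable_gap_iterate k) (fun w => gap_ge0 (x k w)) (gap_bound k).
split => //.
rewrite !big_ord_recr/= -addeA.
apply: (le_trans (leeD2l _ le')).
by rewrite addeA [in leRHS]addrA [leRHS]EFinD; exact: leeD2r.
Qed.

Lemma sum_gap_bound k :
  (\sum_(i < k.+1) (t i)%:E * \int[P]_w (gap (x i w))%:E
   <= (bregman psi xstar x0
       + sigma ^+ 2 / (2 * alpha) * (\sum_(i < k.+1) t i ^+ 2)
       + K * \sum_(i < k.+1) t i)%:E)%E.
Proof.
have [_ le] := iterate_descent k.+1.
have -> : bregman psi xstar x0
       + sigma ^+ 2 / (2 * alpha) * (\sum_(i < k.+1) t i ^+ 2)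
       + K * \sum_(i < k.+1) t i = bregman psi xstar x0
       + \sum_(i < k.+1) (t i ^+ 2 * (sigma ^+ 2 / (2 * alpha)) + t i * K).
  by rewrite big_split/= -!mulr_suml mulrC [K * _]mulrC addrA.
apply: le_trans le; rewrite leeDl//.
by apply: integral_ge0 => w _; rewrite lee_fin (bregman_ge0 alpha_gt0 psi_mirror).
Qed.

Lemma integral_sum_gap k :
  (\int[P]_w (\sum_(i < k.+1) (t i)%:E * (gap (x i w))%:E)
   = \sum_(i < k.+1) (t i)%:E * \int[P]_w (gap (x i w))%:E)%E.
Proof.
have mg i : measurable_fun [set: Omega] (fun w => (gap (x i w))%:E).
  exact/measurable_EFinP/measurable_gap_iterate.
rewrite ge0_integral_sum//; first last.
- by move=> i w _; rewrite mule_ge0// lee_fin ?gap_ge0// ltW.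
- by move=> i; exact: measurable_funeM.
apply: eq_bigr => i _; rewrite ge0_integralZl//; last by rewrite lee_fin ltW.
by move=> w _; rewrite lee_fin gap_ge0.
Qed.

(** Both bounds, for the sum and for the ergodic average, in terms of [K]. *)
Lemma mirror_descent_bounds k :
  (\int[P]_w (\sum_(i < k.+1) (t i)%:E * (f (x i w) - f xstar))
    <= (bregman psi xstar x0
        + sigma ^+ 2 / (2 * alpha) * (\sum_(i < k.+1) t i ^+ 2)
        + K * \sum_(i < k.+1) t i)%:E)%E
  /\
  (\int[P]_w (f (ergodic_average t (x ^~ w) k) - f xstar)
    <= ((bregman psi xstar x0
         + sigma ^+ 2 / (2 * alpha) * (\sum_(i < k.+1) t i ^+ 2))
          / (\sum_(i < k.+1) t i)
        + K)%:E)%E.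
Proof.
have T0 : 0 < \sum_(i < k.+1) t i.
  by rewrite big_ord_recl ltr_pwDl// sumr_ge0// => i _; exact/ltW.
split.
  under eq_integral do under eq_bigr do rewrite gapE.
  by rewrite integral_sum_gap sum_gap_bound.
under eq_integral do rewrite gapE.
set T := \sum_(i < k.+1) t i in T0 *.
have mg i : measurable_fun [set: Omega] (fun w => gap (x i w)).
  exact: measurable_gap_iterate.
apply: (@le_trans _ _ (\int[P]_w ((T^-1)%:E
    * \sum_(i < k.+1) (t i)%:E * (gap (x i w))%:E))%E).
  apply: ge0_le_integral => //.
  - by move=> w _; rewrite lee_fin gap_ge0.
  - apply/measurable_EFinP.
    apply: (measurableT_comp measurable_gap); apply: measurable_fun_mx => i j.
    rewrite ord1; under eq_fun do rewrite /ergodic_average summxE.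
    apply: measurable_sum => l; under eq_fun do rewrite mxE.
    apply: measurable_funM => //.
    exact: (measurableT_comp (measurable_coord j) (iterate_measurable l)).
  - apply: measurable_funeM; apply: emeasurable_sum => i.
    exact/measurable_funeM/measurable_EFinP.
  - move=> w _; under eq_bigr do rewrite -EFinM.
    by rewrite sumEFin -EFinM lee_fin gap_ergodic_average.
rewrite ge0_integralZl//; last 3 first.
- apply: emeasurable_sum => i; exact/measurable_funeM/measurable_EFinP.
- move=> w _; apply: sume_ge0 => i _.
  by rewrite mule_ge0// lee_fin ?gap_ge0// ltW.
- by rewrite lee_fin invr_ge0 ltW.
rewrite integral_sum_gap.
apply: (le_trans (lee_wpmul2l _ (sum_gap_bound k))).
  by rewrite lee_fin invr_ge0 ltW.
rewrite -EFinM lee_fin -/T mulrDr mulrC lerD//.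
by rewrite [K * _]mulrC mulKf// gt_eqF.
Qed.

End convergence.

Theorem theorem2 (R : realType) (n : nat)
    (nrm : 'rV[R]_n -> R) (nrm_norm : is_norm nrm)
    (f : 'rV[R]_n -> \bar R) (f_proper : proper_function f)
    (f_convex : ereal_convex f) (f_lsc : lower_semicontinuous f)
    (g : 'rV[R]_n -> 'cV[R]_n) (g_sub : forall x, subdifferential f x (g x))
    (xstar : 'rV[R]_n) (xstar_min : forall x, (f xstar <= f x)%E)
    (alpha : R) (alpha_gt0 : 0 < alpha)
    (psi : 'rV[R]_n -> R) (psi_mirror : mirror_potential nrm alpha psi)
    (d d' : measure_display)
    (Omega : measurableType d) (P : probability Omega R)
    (Xi : measurableType d') (law : probability Xi R)
    (xi : nat -> {RV P >-> Xi}) (xi_iid : iid law xi)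
    (Delta : 'rV[R]_n -> Xi -> 'cV[R]_n) (U : 'rV[R]_n -> 'cV[R]_n)
    (G : 'rV[R]_n -> Xi -> 'cV[R]_n)
    (G_def : forall x z, G x z = g x + Delta x z + U x)
    (G_measurable : forall j : 'I_n,
      measurable_fun [set: borelType 'rV[R]_n * Xi]
        (fun xz : borelType 'rV[R]_n * Xi => G xz.1 xz.2 j ord0))
    (Delta_mean0 : forall x (j : 'I_n),
      (\int[law]_z (Delta x z j ord0)%:E = 0)%E)
    (sigma : R) (sigma_ge0 : 0 <= sigma)
    (G_moment : forall x,
      (\int[law]_z (dual_norm nrm (G x z) ^+ 2)%:E <= (sigma ^+ 2)%:E)%E)
    (t : nat -> R) (t_gt0 : forall k, 0 < t k)
    (x0 : 'rV[R]_n) (x : nat -> Omega -> 'rV[R]_n)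
    (x_init : forall w, x 0%N w = x0)
    (x_step : forall k w, x k.+1 w =
      gradient_conjugate psi
        (gradient psi (x k w) - t k *: G (x k w) (xi k w))) :
  (forall C : R,
    (forall i, {ae P, forall w, `|pairing (U (x i w)) (x i w - xstar)| <= C}) ->
    forall k : nat,
      (\int[P]_w (\sum_(i < k.+1) (t i)%:E * (f (x i w) - f xstar))
        <= (bregman psi xstar x0
            + sigma ^+ 2 / (2 * alpha) * (\sum_(i < k.+1) t i ^+ 2)
            + C * \sum_(i < k.+1) t i)%:E)%E
      /\
      (\int[P]_w (f (ergodic_average t (x ^~ w) k) - f xstar)
        <= ((bregman psi xstar x0
             + sigma ^+ 2 / (2 * alpha) * (\sum_(i < k.+1) t i ^+ 2))
              / (\sum_(i < k.+1) t i)
            + C)%:E)%E)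
  /\
  (forall mu C' : R, 0 < mu -> strongly_convex nrm mu f g ->
    (forall i, {ae P, forall w, dual_norm nrm (U (x i w)) ^+ 2 <= C'}) ->
    forall k : nat,
      (\int[P]_w (\sum_(i < k.+1) (t i)%:E * (f (x i w) - f xstar))
        <= (bregman psi xstar x0
            + sigma ^+ 2 / (2 * alpha) * (\sum_(i < k.+1) t i ^+ 2)
            + C' / (2 * mu) * \sum_(i < k.+1) t i)%:E)%E
      /\
      (\int[P]_w (f (ergodic_average t (x ^~ w) k) - f xstar)
        <= ((bregman psi xstar x0
             + sigma ^+ 2 / (2 * alpha) * (\sum_(i < k.+1) t i ^+ 2))
              / (\sum_(i < k.+1) t i)
            + C' / (2 * mu))%:E)%E).
Proof.
split.
- move=> C hC; apply: (mirror_descent_bounds nrm_norm f_proper f_lsc g_sub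
    xstar_min alpha_gt0 psi_mirror xi_iid G_def G_measurable Delta_mean0
    G_moment t_gt0 x_init x_step) => i.
  apply: filterS (hC i) => w.
  exact: (gap_le_bounded_error f_proper g_sub).
- move=> mu C' mu0 fsc hC; apply: (mirror_descent_bounds nrm_norm f_proper
    f_lsc g_sub xstar_min alpha_gt0 psi_mirror xi_iid G_def G_measurable
    Delta_mean0 G_moment t_gt0 x_init x_step) => i.
  apply: filterS (hC i) => w.
  exact: (gap_le_strongly_convex nrm_norm xstar f_proper g_sub (x i w) mu0 fsc).
Qed.
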